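(* Let $(X,\nu)$ be a standard Borel space with a non-atomic probability measure $\nu$, let $\Lambda$ be a measure on $\mathbb{R}_+$ satisfying $\Lambda(0,\infty)=\infty$, $\Lambda(1,\infty)<\infty$, $\int_0^1 s\,d\Lambda(s)<\infty$, $\Lambda(\{0\})=0$, and let $\eta=\sum_i Q_i\delta_{X_i}$ be a homogeneous Lévy process on $(X,\nu)$ with Lévy measure $\Lambda$ and law $P_\Lambda$. Then $TP_\Lambda=\varkappa_\Lambda\times\nu^\infty$, where $\varkappa_\Lambda$ is the conic part of $P_\Lambda$; i.e. $X_1,X_2,\ldots$ is a sequence of i.i.d. random variables with common distribution $\nu$, and this sequence is independent of the conic part $\{Q_i\}_{i\in\mathbb{N}}$.
   Context: $D$ is the real vector space of finite real discrete measures $\sum z_i\delta_{x_i}$ ($x_i\in X$, $z_i\in\mathbb{R}$, $\sum|z_i|<\infty$) on $X$, and $D^+\subset D$ is the cone of finite positive discrete measures ($z_i>0$). Let $\psi_\Lambda(t)=\exp\left(-\int_0^\infty(1-e^{-ts})\,d\Lambda(s)\right)$. A homogeneous Lévy process on $(X,\nu)$ with Lévy measure $\Lambda$ is a generalized process (random element $\eta$) on $D$ whose law $P_\Lambda$ has the Laplace transform $$\mathbb{E}\left[\exp\left(-\int_X a(x)\,d\eta(x)\right)\right]=\exp\left(\int_X\log\psi_\Lambda(a(x))\,d\nu(x)\right)$$ for every non-negative bounded Borel function $a$ on $X$. The law $P_\Lambda$ is concentrated on $D^+$. (Explicitly, $\eta=\sum_{(X_i,Z_i)\in\Pi}Z_i\delta_{X_i}$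 with $\Pi$ a Poisson point process on $X\times\mathbb{R}_+$ with mean measure $\nu\times\Lambda$.) Let $C=\{z=(z_1,z_2,\ldots): z_1\ge z_2\ge\ldots\ge0,\ \sum z_i<\infty\}$. The map $T:D^+\to C\times X^\infty$ is defined by $T\eta=\big((Q_1,Q_2,\ldots),(X_1,X_2,\ldots)\big)$ if $\eta=\sum_i Q_i\delta_{X_i}$, and $TP_\Lambda$ is the image of $P_\Lambda$ under $T$. The random sequence of charges $(Q_1,Q_2,\ldots)\in C$ is called the conic part of the process $\eta$, and its distribution $\varkappa_\Lambda$ on $C$ is called the conic part of the law $P_\Lambda$.
   Formalization: If Λ has atoms, equal charges occur with positive probability and T is not well defined (a fixed tie-break makes the X_i dependent); here T may use auxiliary randomness and is assumed to list atoms of equal charge in exchangeable random order, a condition void when the charges are distinct. *)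

(* Defs.v *)
From HB Require Import structures.
From mathcomp Require Import all_boot all_order all_algebra.
From mathcomp Require Import all_classical all_reals all_analysis.
From mathcomp Require Import measurable_realfun.
Set Implicit Arguments.
Unset Strict Implicit.
Unset Printing Implicit Defensive.
Import Order.TTheory GRing.Theory Num.Theory.
Import numFieldNormedType.Exports.
Local Open Scope classical_set_scope.
Local Open Scope ring_scope.

Definition polish (R : realType) (Y : completePseudoMetricType R) : Prop :=
  hausdorff_space Y /\ exists2 S : set Y, countable S & dense S.

Definition standard_borel (R : realType) (d : measure_display)
    (X : measurableType d) : Prop :=
  exists (Y : completePseudoMetricType R) (f : X -> Y),
    [/\ polish Y, bijective f &
        forall A : set X, measurable A <-> <<s @open Y >> (f @` A)].

Definition nonatomic (R : realType) (d : measure_display)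
    (X : measurableType d) (mu : {measure set X -> \bar R}) : Prop :=
  forall A : set X, measurable A -> (0 < mu A)%E ->
    exists B : set X, [/\ measurable B, B `<=` A & (0 < mu B < mu A)%E].

Definition cylinders (S : Type) (d : measure_display) (X : measurableType d)
    (coord : nat -> S -> X) : set (set S) :=
  \bigcup_i preimage_set_system setT (coord i) measurable.

(* X^oo with the product sigma-algebra. *)
Definition seq_space (d : measure_display) (X : measurableType d) :
    measurableType _ :=
  g_sigma_algebraType (cylinders (fun i (x : nat -> X) => x i)).

Record conic_seq (R : realType) := ConicSeq {
  charge_of :> nat -> R;
  charge_of_noninc : forall i j, (i <= j)%N -> charge_of j <= charge_of i;
  charge_of_ge0 : forall i, 0 <= charge_of i;
  charge_of_summable : cvgn (series charge_of) }.

HB.instance Definition _ (R : realType) := gen_eqMixin (conic_seq R).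
HB.instance Definition _ (R : realType) := gen_choiceMixin (conic_seq R).

Lemma conic0_summable (R : realType) : cvgn (series (fun _ : nat => 0 : R)).
Proof.
rewrite (_ : series _ = fun=> 0); first exact: is_cvg_cst.
by apply/funext => n; rewrite /series /= big1.
Qed.

Definition conic0 (R : realType) : conic_seq R :=
  @ConicSeq R (fun=> 0) (fun _ _ _ => lexx 0) (fun=> lexx 0)
    (@conic0_summable R).

HB.instance Definition _ (R : realType) := isPointed.Build (conic_seq R) (conic0 R).

(* The cone C with the sigma-algebra generated by the coordinates. *)
Definition conic_space (R : realType) : measurableType _ :=
  g_sigma_algebraType
    (cylinders (fun i (q : conic_seq R) => (q i : measurableTypeR R))).

(* (sum_i q_i delta_{x_i})(A); discrete measures make sense on every set A. *)
Definition atomic_sum (R : realType) (d : measure_display)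
    (X : measurableType d) (q : nat -> R) (x : nat -> X) (A : set X) : \bar R :=
  (\sum_(0 <= i <oo) (q i)%:E * \d_(x i) A)%E.

(* The cone D^+.  Zero coefficients are allowed so that finite sums of Dirac
   masses (and the null measure) are covered by infinite sequences; finiteness
   of the measure gives the summability of the coefficients. *)
Record dplus (R : realType) (d : measure_display) (X : measurableType d) :=
  DPlus {
  dplus_measure :> {finite_measure set X -> \bar R};
  dplus_discrete : exists (q : nat -> R) (x : nat -> X),
    (forall i, 0 <= q i) /\
    (forall A : set X, dplus_measure A = atomic_sum q x A) }.

HB.instance Definition _ (R : realType) (d : measure_display)
  (X : measurableType d) := gen_eqMixin (dplus R X).
HB.instance Definition _ (R : realType) (d : measure_display)
  (X : measurableType d) := gen_choiceMixin (dplus R X).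

Lemma dplus0_discrete (R : realType) (d : measure_display)
    (X : measurableType d) : exists (q : nat -> R) (x : nat -> X),
  (forall i, 0 <= q i) /\ (forall A : set X, @mzero d X R A = atomic_sum q x A).
Proof.
exists (fun=> 0), (fun=> point); split => // A.
by rewrite /atomic_sum eseries0// => i _ _; rewrite mul0e.
Qed.

Definition dplus0 (R : realType) (d : measure_display) (X : measurableType d) :
  dplus R X := @DPlus R d X (@mzero d X R) (@dplus0_discrete R d X).

HB.instance Definition _ (R : realType) (d : measure_display)
  (X : measurableType d) := isPointed.Build (dplus R X) (dplus0 R X).

Definition evaluation (R : realType) (d : measure_display)
    (X : measurableType d) (A : set X) (eta : dplus R X) : \bar R := eta A.

(* D^+ with the sigma-algebra generated by the evaluations eta |-> eta(A). *)
Definition dplus_space (R : realType) (d : measure_display)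
    (X : measurableType d) : measurableType _ :=
  g_sigma_algebraType
    (\bigcup_(A in [set A : set X | measurable A])
       preimage_set_system setT (evaluation A)
         (measurable : set (set (\bar R)))).

Definition psi (R : realType)
    (Lambda : {measure set (measurableTypeR R) -> \bar R}) (t : R) : R :=
  expR (- \int[Lambda]_(s in `]0, +oo[%classic) (1 - expR (- (t * s)))).

Definition levy_law (R : realType) (d : measure_display) (X : measurableType d)
    (nu : {measure set X -> \bar R})
    (Lambda : {measure set (measurableTypeR R) -> \bar R})
    (P : probability (dplus_space R X) R) : Prop :=
  forall a : X -> R, measurable_fun [set: X] a -> (forall x, 0 <= a x) ->
    (exists M, forall x, a x <= M) ->
    \int[P]_eta expR (- \int[(eta : dplus R X)]_x a x) =
    expR (\int[nu]_x ln (psi Lambda (a x))).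

(* The x_i carrying a positive charge are distinct, i.e. q lists the masses of
   the atoms of eta. *)
Definition ordered_atoms (R : realType) (d : measure_display)
    (X : measurableType d) (eta : dplus R X) (q : conic_seq R) (x : nat -> X) :
    Prop :=
  (forall A : set X, eta A = atomic_sum q x A) /\
  (forall i j, 0 < q i -> 0 < q j -> x i = x j -> i = j).

Definition swap_coords (X : Type) (i j : nat) (x : nat -> X) : nat -> X :=
  fun k => x (if k == i then j else if k == j then i else k).

(* eta does not determine the order in which atoms of equal charge are listed,
   so the map eta |-> (q, x) takes an auxiliary random argument w of law U.
   A plain map on D^+ is the case where w is ignored. *)
Definition ordering_map (R : realType) (d d' : measure_display)
    (X : measurableType d) (W : measurableType d')
    (T : (dplus_space R X * W)%type -> (conic_space R * seq_space X)%type) :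
    Prop :=
  forall eta w, ordered_atoms eta (T (eta, w)).1 (T (eta, w)).2.

(* The atoms of eta with a given charge are listed in uniformly random order:
   exchanging two positions of equal charge does not change the law of x (the
   transpositions generate the permutations inside each group of ties).  This
   is void when the charges of eta are pairwise distinct.  Other conventions,
   e.g. a fixed order of X, would make the tied positions dependent. *)
Definition fair_ties (R : realType) (d d' : measure_display)
    (X : measurableType d) (W : measurableType d') (U : probability W R)
    (T : (dplus_space R X * W)%type -> (conic_space R * seq_space X)%type)
    (eta : dplus_space R X) : Prop :=
  forall i j,
    (forall w, let q : conic_seq R := (T (eta, w)).1 in 0 < q i /\ q i = q j) ->
    forall B : set (seq_space X), measurable B ->
      U [set w | B (swap_coords i j (T (eta, w)).2)] =
      U [set w | B (T (eta, w)).2].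

Section random_sequences.
Context (R : realType) (d d' : measure_display) (X : measurableType d)
  (Om : measurableType d').

Definition charges (T : {mfun Om >-> (conic_space R * seq_space X)%type})
  (om : Om) : conic_space R := (T om).1.

Definition positions (T : {mfun Om >-> (conic_space R * seq_space X)%type})
  (om : Om) : seq_space X := (T om).2.

Lemma measurable_charges T : measurable_fun setT (charges T).
Proof. exact: (measurableT_comp measurable_fst). Qed.

HB.instance Definition _ T :=
  isMeasurableFun.Build _ _ _ _ (charges T) (measurable_charges T).

End random_sequences.

(* rho = nu^oo *)
Definition infinite_power (R : realType) (d : measure_display)
    (X : measurableType d) (nu : probability X R)
    (rho : probability (seq_space X) R) : Prop :=
  forall (n : nat) (B : nat -> set X), (forall i, measurable (B i)) ->
    rho [set x : nat -> X | forall i, (i < n)%N -> B i (x i)] =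
    (\prod_(i < n) nu (B i))%E.

Definition iid_with_law (R : realType) (d d' : measure_display)
    (X : measurableType d) (Om : measurableType d') (Pr : probability Om R)
    (nu : probability X R) (x : nat -> Om -> X) : Prop :=
  (forall i (B : set X), measurable B -> Pr (x i @^-1` B) = nu B) /\
  (forall (n : nat) (B : nat -> set X), (forall i, measurable (B i)) ->
    Pr [set om | forall i, (i < n)%N -> B i (x i om)] =
    (\prod_(i < n) Pr (x i @^-1` B i))%E).

Definition independent (R : realType) (d d1 d2 : measure_display)
    (Om : measurableType d) (S1 : measurableType d1) (S2 : measurableType d2)
    (Pr : probability Om R) (f : Om -> S1) (g : Om -> S2) : Prop :=
  forall (A : set S1) (B : set S2), measurable A -> measurable B ->
    Pr (f @^-1` A `&` g @^-1` B) = (Pr (f @^-1` A) * Pr (g @^-1` B))%E.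

(* Main.v *)
Require Import Defs.
From HB Require Import structures.
From mathcomp Require Import all_boot all_order all_algebra fingroup perm.
From mathcomp Require Import all_classical all_reals all_analysis.
From mathcomp Require Import measurable_realfun ring lra.
Set Implicit Arguments.
Unset Strict Implicit.
Unset Printing Implicit Defensive.
Import Order.TTheory GRing.Theory Num.Theory.
Import numFieldNormedType.Exports.
Local Open Scope classical_set_scope.
Local Open Scope ring_scope.

(** A Lévy process does not change its law when the positions of its atoms are
    resampled. Let kappa be the law of the ordered charges Q of the process, let
    Y be a sequence of law [nu^oo] independent of Q, let P' be the law of the
    measure [sum_i Q_i delta_(Y_i)]. The heart of the proof is the equality
    P = P' ([resampled_law]).

    Once it is known, apply the ordering map to the resampled measure. It returns
    the charges Q, and the sequence Y composed with a bijection that preserves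
    the charges ([ordered_atoms_unique]). Only the order of tied atoms is left to
    chance, and fairness makes the conditional law of the first positions the
    average over the permutations of the ties ([fair_average]). As Y is
    exchangeable and independent of Q, this average is again distributed as Y,
    whatever Q is ([resampled_positions]). So the positions have law [nu^oo] and
    are independent of the charges ([ordering_law_product]). This uses that the
    positions Y are distinct, because [nu] has no atoms
    ([infinite_power_injective]), and that all charges are positive: the Laplace
    exponent is unbounded because [Lambda] is infinite, so each set of positive
    mass is almost surely charged, and there are infinitely many disjoint ones
    ([charges_positive]).

    To prove P = P', compare Laplace transforms, which determine the law because
    polynomials in [exp (- t * eta A)] approximate the indicator of
    [c < eta A] ([laplace_unique]). Let [a] take the value [phi k] on the cell
    [C k] of a finite partition, and put
    [L q = sum_k nu (C k) * exp (- phi k * q)]. Under P', integrating out Y shows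
    that [exp (- eta a)] has the same expectation as the product of the [L (Q_i)]
    ([resampled_laplace]). This expectation has to be computed from the Laplace
    functional of P, which does not see the individual charges. Cut X into the
    cells of finer and finer partitions that separate points
    ([standard_borel_separating]). The product over the cells of [L (eta cell)]
    tends to the product of the [L (Q_i)], since eventually each cell contains at
    most one of the large atoms ([prod_cells_cvg]). On the other hand its
    expectation is explicit, since the masses of the cells are independent with
    known Laplace transforms ([expected_cells_product]). The sum of the squares
    of the [nu]-masses of the cells tends to zero, because [nu] has no atoms
    ([cell_mass_sq_cvg0]), so a first-order expansion in these masses gives the
    limit: the exponential of minus the sum of the [nu (C k)] times the Laplace
    exponent at [phi k], which is the value that the Laplace functional of P
    takes at [a] ([expected_charge_product_cvg]).

    The measure [nu^oo] is built from its values on cylinder sets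
    ([infinite_powerP]). *)

(** * Infinite powers of a probability measure *)

Section seq_space_basics.
Context d (X : measurableType d).

Lemma measurable_coord i : measurable_fun setT (fun x : seq_space X => (x : nat -> X) i).
Proof.
move=> _ B mB; apply: sub_sigma_algebra; exists i => //.
by exists B.
Qed.

Lemma measurable_to_seq d' (S : measurableType d') (f : S -> seq_space X) :
  (forall i, measurable_fun setT (fun s => (f s : nat -> X) i)) ->
  measurable_fun setT f.
Proof.
move=> mf; refine (@measurability _ _ S (seq_space X) setT f (cylinders (fun i (x : nat -> X) => x i)) _ _) => //.
move=> _ [_ [i _ [B mB <-]] <-]; rewrite setTI.
have := mf i measurableT B mB.
by rewrite setTI => h; rewrite setTI.
Qed.

Definition scons (x : X) (s : nat -> X) : nat -> X :=
  fun n => if n is m.+1 then s m else x.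

Definition scons_pair (p : X * seq_space X) : seq_space X := scons p.1 p.2.

Lemma measurable_scons_pair : measurable_fun setT scons_pair.
Proof.
apply: measurable_to_seq => -[|i] /=; first exact: measurable_fst.
exact: (measurableT_comp (measurable_coord i) measurable_snd).
Qed.

HB.instance Definition _ := isMeasurableFun.Build _ _ _ _ scons_pair measurable_scons_pair.

Definition determined_by n (A : set (seq_space X)) :=
  forall x y : nat -> X, (forall i, (i < n)%N -> x i = y i) -> A x -> A y.

Definition cylinder_set (A : set (seq_space X)) := measurable A /\ exists n, determined_by n A.

Lemma determined_byW n m A : (n <= m)%N -> determined_by n A -> determined_by m A.
Proof. by move=> nm lA x y xy; apply: lA => i /leq_trans/(_ nm); exact: xy. Qed.

Lemma cylinder_set0 : cylinder_set set0.
Proof. by split => //; exists 0%N. Qed.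

Lemma cylinder_setC A : cylinder_set A -> cylinder_set (~` A).
Proof.
move=> [mA [n lA]]; split; first exact: measurableC.
exists n => x y xy nAx Ay; apply: nAx; apply: lA Ay => i ?; exact/esym/xy.
Qed.

Lemma cylinder_setU A B : cylinder_set A -> cylinder_set B -> cylinder_set (A `|` B).
Proof.
move=> [mA [n lA]] [mB [m lB]]; split; first exact: measurableU.
exists (maxn n m) => x y xy [Ax|Bx].
  by left; apply: (determined_byW (leq_maxl n m) lA) Ax.
by right; apply: (determined_byW (leq_maxr n m) lB) Bx.
Qed.

Definition head_section (A : set (seq_space X)) (x : X) : set (seq_space X) := [set s | A (scons x s)].

Lemma head_sectionE A x : head_section A x = xsection (scons_pair @^-1` A) x.
Proof. by apply/seteqP; split=> s /=; rewrite /xsection /= inE. Qed.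

Lemma measurable_head_section A x : measurable A -> measurable (head_section A x).
Proof.
move=> mA; rewrite head_sectionE; apply: measurable_xsection.
by rewrite -[X in measurable X]setTI; exact: measurable_scons_pair.
Qed.

Lemma determined_by_head_section n A x : determined_by n.+1 A -> determined_by n (head_section A x).
Proof.
by move=> lA s t st; apply: lA => -[//|i]; rewrite ltnS; exact: st.
Qed.

Lemma cylinder_head_section A x : cylinder_set A -> cylinder_set (head_section A x).
Proof.
move=> [mA [n lA]]; split; first exact: measurable_head_section.
by exists n; apply: determined_by_head_section; apply: determined_byW lA.
Qed.

End seq_space_basics.

(** A copy of the type of sequences that carries the algebra of cylinder sets,
    on which a measure can be built before it is extended to the generated
    sigma-algebra. *)
Definition cyl_space d (X : measurableType d) := nat -> X.

HB.instance Definition _ d (X : measurableType d) := Pointed.on (cyl_space X).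
Fact cyl_display : measure_display. Proof. exact: (default_measure_display). Qed.
HB.instance Definition _ d (X : measurableType d) :=
  @isAlgebraOfSets.Build cyl_display (cyl_space X) (@cylinder_set d X)
    (@cylinder_set0 d X) (@cylinder_setU d X) (@cylinder_setC d X).

Definition box d (X : measurableType d) n (B : nat -> set X) : set (seq_space X) :=
  [set x : nat -> X | forall i, (i < n)%N -> B i (x i)].

Lemma measurable_box d (X : measurableType d) n (B : nat -> set X) :
  (forall i, measurable (B i)) -> measurable (box n B).
Proof.
move=> mB.
rewrite (_ : box n B = \bigcap_(i in `I_n) ((fun x : seq_space X => (x : nat -> X) i) @^-1` B i)).
  apply: fin_bigcap_measurable => // i _.
  by have := measurable_coord i measurableT (mB i); rewrite setTI.
by apply/seteqP; split.
Qed.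

Lemma determined_by_box d (X : measurableType d) n (B : nat -> set X) : determined_by n (box n B).
Proof. by move=> x y xy h i ni; rewrite -xy//; exact: h. Qed.

Section infinite_product.
Context (R : realType) d (X : measurableType d) (nu : probability X R).

(** The law of a sequence whose first [n] coordinates are iid of law [nu] and
    whose other coordinates are constant. On a set determined by finitely many
    coordinates they agree from some [n] on, and the common value is the mass
    of that set under the infinite power. *)
Fixpoint iid_prefix (n : nat) : probability (seq_space X) R :=
  if n is m.+1 then
    distribution (nu \x iid_prefix m : probability (X * seq_space X)%type R)%E (@scons_pair d X : {mfun _ >-> _})
  else \d_(point : seq_space X).

Lemma iid_prefixS n A : measurable A ->
  iid_prefix n.+1 A = (\int[nu]_x iid_prefix n (head_section A x))%E.
Proof.
move=> mA /=; rewrite /distribution /pushforward /= /product_measure1.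
by apply: eq_integral => x _ /=; rewrite head_sectionE.
Qed.

Lemma iid_prefix_stable n m A : measurable A -> determined_by n A -> (n <= m)%N -> iid_prefix m A = iid_prefix n A.
Proof.
elim: n m A => [|n IH] m A mA lA nm.
  have [A0|A1] := pselect (A point).
    suff -> : A = setT by rewrite !probability_setT.
    by apply/seteqP; split => // x _; apply: lA A0.
  suff -> : A = set0 by rewrite !measure0.
  by apply/seteqP; split => // x Ax; apply: A1; apply: lA Ax.
case: m nm => // m nm; rewrite !iid_prefixS//; apply: eq_integral => x _.
by apply: IH => //; [exact: measurable_head_section|exact: determined_by_head_section].
Qed.

Definition cylinder_mass (A : set (cyl_space X)) : \bar R := limn (fun n => iid_prefix n A).

Lemma cylinder_massE n A : measurable (A : set (seq_space X)) -> determined_by n A -> cylinder_mass A = iid_prefix n A.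
Proof.
move=> mA lA; apply: lim_near_cst => //.
by exists n => // m /= nm; rewrite (iid_prefix_stable mA lA nm).
Qed.

Lemma cylinder_mass_ge0 (A : set (cyl_space X)) : (0 <= cylinder_mass A)%E.
Proof.
(* On a set that is not a cylinder the sequence may diverge, and its [lim] is
   then the default value [0]. *)
have [c|/dvgP] := pselect (cvgn (fun n => iid_prefix n A)); last by rewrite /cylinder_mass => ->.
by apply: lime_ge => //; near=> n.
Unshelve. all: by end_near. Qed.

(** Fubini in the first coordinate. It is what allows the points of a
    decreasing intersection to be chosen one coordinate after the other. *)
Lemma cylinder_mass_section (A : set (cyl_space X)) : measurable A ->
  cylinder_mass A = (\int[nu]_x cylinder_mass (head_section A x))%E.
Proof.
move=> [mA [n lA]]; have lA' := determined_byW (leqnSn n) lA.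
rewrite (cylinder_massE mA lA') iid_prefixS//; apply: eq_integral => x _.
by rewrite (cylinder_massE (measurable_head_section x mA) (determined_by_head_section (x := x) lA')).
Qed.

Lemma measurable_cylinder_mass_section (A : set (cyl_space X)) : measurable A ->
  measurable_fun setT (fun x => cylinder_mass (head_section A x)).
Proof.
move=> [mA [n lA]]; have lA' := determined_byW (leqnSn n) lA.
rewrite (_ : (fun x => _) = iid_prefix n \o xsection (@scons_pair d X @^-1` A)).
  apply: measurable_fun_xsection.
  by rewrite -[X in measurable X]setTI; exact: measurable_scons_pair.
apply/funext => x /=; rewrite -head_sectionE.
by rewrite (cylinder_massE (measurable_head_section x mA) (determined_by_head_section (x := x) lA')).
Qed.

Lemma cylinder_mass_le1 (A : set (cyl_space X)) : measurable A -> (cylinder_mass A <= 1)%E.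
Proof. by move=> [mA [n lA]]; rewrite (cylinder_massE mA lA) probability_le1. Qed.

Lemma cylinder_mass_additive (A B : set (cyl_space X)) : measurable A -> measurable B ->
  A `&` B = set0 -> cylinder_mass (A `|` B) = (cylinder_mass A + cylinder_mass B)%E.
Proof.
move=> mA mB AB; have [mA' [n lA]] := mA; have [mB' [m lB]] := mB.
have lA' := determined_byW (leq_maxl n m) lA; have lB' := determined_byW (leq_maxr n m) lB.
have lAB : determined_by (maxn n m) (A `|` B : set (seq_space X)).
  by move=> x y xy [Ax|Bx]; [left; exact: lA' Ax|right; exact: lB' Bx].
rewrite (cylinder_massE mA' lA') (cylinder_massE mB' lB') (cylinder_massE _ lAB); last exact: measurableU.
by rewrite measureU.
Qed.

Lemma cylinder_mass_le (A B : set (cyl_space X)) : measurable A -> measurable B ->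
  A `<=` B -> (cylinder_mass A <= cylinder_mass B)%E.
Proof.
move=> mA mB AB; rewrite [in leRHS](_ : B = A `|` (B `\` A)); last by rewrite setDUK.
rewrite cylinder_mass_additive//; last 2 first.
- exact: measurableD.
- by rewrite setIDA setIC -setIDA setDv setI0.
by rewrite leeDl// cylinder_mass_ge0.
Qed.

Definition nonvanishing (A : nat -> set (cyl_space X)) :=
  exists2 e : R, 0 < e & forall k, (e%:E <= cylinder_mass (A k))%E.

Lemma vanishing_cvg0 (A : nat -> set (cyl_space X)) : (forall k, measurable (A k)) ->
  (forall k, A k.+1 `<=` A k) -> ~ nonvanishing A -> cylinder_mass (A k) @[k --> \oo] --> 0%E.
Proof.
move=> mA dA ncA.
have fA k : cylinder_mass (A k) \is a fin_num.
  rewrite ge0_fin_numE ?cylinder_mass_ge0//.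
  by rewrite (le_lt_trans (cylinder_mass_le1 _))// ltry.
apply/fine_cvgP; split; first by near=> k.
apply/cvgrPdist_lt => e e0.
have [k0 hk] : exists k0, (cylinder_mass (A k0) < e%:E)%E.
  apply: contrapT => /forallNP h; apply: ncA; exists e => // k.
  by rewrite leNgt; apply/negP.
exists k0 => // k /= k0k; rewrite sub0r normrN.
rewrite ger0_norm ?fine_ge0 ?cylinder_mass_ge0//.
rewrite -lte_fin fineK//; apply: le_lt_trans hk.
rewrite cylinder_mass_le//; elim: k k0k => [|k IH]; first by rewrite leqn0 => /eqP ->.
rewrite leq_eqVlt => /predU1P[->//|]; rewrite ltnS => /IH; apply: subset_trans.
exact: dA.
Unshelve. all: by end_near. Qed.

(** If every section had vanishing mass, dominated convergence in the first
    coordinate would make the mass of the sets themselves vanish. *)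
Lemma nonvanishing_section (A : nat -> set (cyl_space X)) : (forall k, measurable (A k)) ->
  (forall k, A k.+1 `<=` A k) -> nonvanishing A ->
  exists x, nonvanishing (fun k => head_section (A k) x).
Proof.
move=> mA dA [e e0 eA]; apply: contrapT => /forallNP h.
have ms k x : measurable (head_section (A k) x : set (cyl_space X)).
  exact: cylinder_head_section (mA k).
have c0 x : cylinder_mass (head_section (A k) x) @[k --> \oo] --> 0%E.
  by apply: vanishing_cvg0 => // k s; exact: dA.
have := @dominated_convergence _ _ _ nu setT measurableT
  (fun k x => cylinder_mass (head_section (A k) x)) (cst 0%E) (cst 1%E).
case.
- by move=> k; exact: measurable_cylinder_mass_section.
- exact: measurable_cst.
- by apply/aeW => x _; exact: c0.
- exact: finite_measure_integrable_cst.
- apply/aeW => x k _; rewrite gee0_abs ?cylinder_mass_ge0//; exact: cylinder_mass_le1.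
move=> _ _; rewrite integral_cst// mul0e.
rewrite (_ : [sequence _]_n = fun k => cylinder_mass (A k)); last first.
  by apply/funext => k; rewrite /= [RHS]cylinder_mass_section.
move=> /cvg_lim => /(_ (@ereal_hausdorff R)) lim0.
have : (e%:E <= limn (fun k => cylinder_mass (A k)))%E.
  apply: lime_ge; last by near=> k; exact: eA.
  apply: ereal_nonincreasing_is_cvgn.
  apply/nonincreasing_seqP => k; exact: cylinder_mass_le.
by rewrite lim0 lee_fin leNgt e0.
Unshelve. all: by end_near. Qed.

(** Continuity at the empty set, by Halmos' argument: choose by
    [nonvanishing_section] a first coordinate that keeps the masses of the
    sections away from zero, then a second one, and so on. The sequence
    obtained lies in each [A k], because [A k] depends on finitely many
    coordinates and its section at enough of them is not empty. *)
Lemma nonvanishing_bigcap (A : nat -> set (cyl_space X)) : (forall k, measurable (A k)) ->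
  (forall k, A k.+1 `<=` A k) -> nonvanishing A -> \bigcap_k A k !=set0.
Proof.
move=> mA dA cA.
pose good (B : nat -> set (cyl_space X)) :=
  [/\ forall k, measurable (B k), forall k, B k.+1 `<=` B k & nonvanishing B].
have /choice[f fP] : forall B, exists x, good B -> good (fun k => head_section (B k) x).
  move=> B; have [[mB dB cB]|ngB] := pselect (good B); last by exists point.
  have [x cx] := nonvanishing_section mB dB cB.
  exists x => _; split => // k; first exact: cylinder_head_section (mB k).
  by move=> s; exact: dB.
pose B := fix B j := if j is i.+1 then fun k => head_section (B i k) (f (B i)) else A.
have gB j : good (B j) by elim: j => [|j IH] //=; exact: fP.
pose x j := f (B j).
(* [x] is built from its sections: prefixing [t] with the first [j]
   terms of [x] moves it from the [j]-fold section back into the original set. *)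
have Bx j k t : B j k t -> A k (fun i => if (i < j)%N then x i else t (i - j)%N).
  elim: j t => [|j IH] t /=.
    by move=> At; rewrite (_ : (fun i => _) = t)//; apply/funext => i; rewrite subn0.
  move=> /IH; congr (A k _); apply/funext => i.
  have [->|ij] := eqVneq i j; first by rewrite ltnn ltnSn subnn.
  rewrite (_ : (i < j.+1)%N = (i < j)%N); last by rewrite ltnS leq_eqVlt (negPf ij).
  case: ltnP => // ji; have : (j < i)%N by rewrite ltn_neqAle eq_sym ij.
  by case: i {ij ji} => // i; rewrite ltnS => ji; rewrite subSn// subSS.
exists x => k _; have [mAk [n lAk]] := mA k.
have [_ _ [e e0 /(_ k) eB]] := gB n.
(* Since [A k] is determined by [n] coordinates, its [n]-fold section is empty
   or full, and its mass is positive. *)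
have [t Bt] : B n k !=set0.
  apply/set0P/eqP => B0; move: eB; rewrite B0.
  by rewrite (@cylinder_massE 0%N)// ?measure0 ?lee_fin ?leNgt ?e0.
by apply: lAk (Bx _ _ _ Bt) => i ->.
Qed.

(** Finite additivity reduces the claim to the remainders [C k], which
    decrease to the empty set. *)
Lemma cylinder_mass_sigma_additive : semi_sigma_additive cylinder_mass.
Proof.
move=> F mF tF mUF; set B := \bigcup_n F n.
pose C k := B `\` \big[setU/set0]_(i < k) F i.
have mC k : measurable (C k) by apply: measurableD => //; exact: bigsetU_measurable.
have CS k : C k.+1 `<=` C k.
  by move=> s [Bs nF]; split => //; apply: contra_not nF; rewrite big_ord_recr /=; left.
have CE k : C k = F k `|` C k.+1.
  apply/seteqP; split=> s.
    move=> [Bs nF]; have [Fks|nFks] := pselect (F k s); [by left|right].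
    by split => //; rewrite big_ord_recr/= => -[].
  move=> [Fks|]; last exact: CS.
  split; first by exists k.
  rewrite -bigcup_mkord => -[i /= ik Fis].
  have := tF i k I I; move=> /(_ (ex_intro _ s (conj Fis Fks))) ik'.
  by rewrite ik' ltnn in ik.
have sumE k : cylinder_mass B = (\sum_(0 <= i < k) cylinder_mass (F i) + cylinder_mass (C k))%E.
  elim: k => [|k IH].
    by rewrite big_geq// add0e /C big_ord0 setD0.
  rewrite IH big_nat_recr//= -addeA; congr (_ + _)%E.
  rewrite {1}CE cylinder_mass_additive//.
  apply/seteqP; split=> // s [Fks [_]]; apply.
  by rewrite big_ord_recr/=; right.
have fin (A : set (cyl_space X)) : measurable A -> cylinder_mass A \is a fin_num.
  move=> mA; rewrite ge0_fin_numE ?cylinder_mass_ge0//.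
  by rewrite (le_lt_trans (cylinder_mass_le1 _))// ltry.
have C0 : cylinder_mass (C k) @[k --> \oo] --> 0%E.
  apply: vanishing_cvg0 => // cC.
  have [s Cs] := nonvanishing_bigcap mC CS cC.
  have [[i _ Fis] _] := Cs 0%N I.
  by have [_] := Cs i.+1 I; apply; rewrite big_ord_recr/=; right.
rewrite (_ : (fun n => _) = (fun k => cylinder_mass B - cylinder_mass (C k))%E); last first.
  by apply/funext => k; rewrite (sumE k) addeK// fin.
rewrite -[X in _ --> X](sube0 (cylinder_mass B)).
apply: cvgeB => //; last exact: cvg_cst.
by rewrite oppe0; apply: fin_num_adde_defl.
Qed.

Lemma cylinder_mass0 : cylinder_mass set0 = 0%E.
Proof. by rewrite (@cylinder_massE 0%N)// ?measure0. Qed.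

HB.instance Definition _ := isMeasure.Build _ _ _ cylinder_mass cylinder_mass0
  cylinder_mass_ge0 cylinder_mass_sigma_additive.

Let I : measurableType _ := g_sigma_algebraType (@measurable _ (cyl_space X)).

Let to_seq (x : I) : seq_space X := x.

Let measurable_to_seq_ext : measurable_fun setT to_seq.
Proof.
apply: measurable_to_seq => i _ B mB; rewrite setTI; apply: sub_sigma_algebra; split.
  by have := measurable_coord i measurableT mB; rewrite setTI.
by exists i.+1 => x y xy; rewrite /to_seq /= xy.
Qed.

HB.instance Definition _ := isMeasurableFun.Build _ _ _ _ to_seq measurable_to_seq_ext.

Definition power_ext : set I -> \bar R := measure_extension cylinder_mass.

HB.instance Definition _ := Measure.on power_ext.

Let power_extE (A : set (seq_space X)) : cylinder_set A -> power_ext A = cylinder_mass A.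
Proof. by move=> cA; rewrite /power_ext /measure_extension measurable_mu_extE. Qed.

Let power_ext_setT : power_ext setT = 1%E.
Proof.
rewrite power_extE; last by split => //; exists 0%N.
by rewrite (@cylinder_massE 0%N)//= probability_setT.
Qed.

HB.instance Definition _ := Measure_isProbability.Build _ _ _ power_ext power_ext_setT.

Definition power_measure : probability (seq_space X) R :=
  distribution (power_ext : probability I R) (to_seq : {mfun _ >-> _}).

Lemma power_measureE (A : set (seq_space X)) : cylinder_set A -> power_measure A = cylinder_mass A.
Proof. by move=> cA; rewrite -power_extE. Qed.

Lemma iid_prefix_box n (B : nat -> set X) : (forall i, measurable (B i)) ->
  iid_prefix n (box n B) = (\prod_(i < n) nu (B i))%E.
Proof.
elim: n B => [|n IH] B mB.
  rewrite big_ord0 (_ : box _ _ = setT) ?probability_setT//.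
  by apply/seteqP; split.
have mB' i : measurable (B i.+1) by [].
rewrite iid_prefixS; last exact: measurable_box.
under eq_integral => x _.
  rewrite (_ : iid_prefix n _ = ((\1_(B 0%N) x)%:E * \prod_(i < n) nu (B i.+1)))%E; last first.
    rewrite -(IH (fun i => B i.+1))// indicE; case: (boolP (x \in B 0%N)) => Bx.
      rewrite mul1e; congr (iid_prefix n _); apply/seteqP; split=> s /=.
        by move=> h i ni; exact: (h i.+1).
      by move=> h [_|i ni]; [exact: set_mem|exact: h].
    rewrite mul0e [X in iid_prefix n X](_ : _ = set0)// -subset0 => s /= /(_ 0%N erefl) B0.
    by move: Bx; rewrite notin_setE => /(_ B0).
  over.
rewrite ge0_integralZr//=; last 2 first.
- exact/measurable_EFinP.
- by apply: prode_ge0 => i _.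
by rewrite integral_indic// setIT big_ord_recl.
Qed.

Lemma infinite_powerP : infinite_power nu power_measure.
Proof.
move=> n B mB; rewrite -iid_prefix_box// -/(box n B).
have mS := measurable_box n mB; have lB := @determined_by_box _ X n B.
by rewrite power_measureE ?(cylinder_massE _ lB)//; split => //; exists n.
Qed.

End infinite_product.

(** * Finite partitions that separate points *)

Section codes.
Context d (X : measurableType d).

(** A measurable map to a finite type stands for a finite measurable
    partition, indexed by its values; integrals of functions of a code are
    finite sums. *)
Definition measurable_code (K : Type) (c : X -> K) := forall k, measurable (c @^-1` [set k]).

Lemma measurable_code_preimage (K : finType) (c : X -> K) (A : set K) :
  measurable_code c -> measurable (c @^-1` A).
Proof.
move=> mc; rewrite (_ : _ @^-1` _ = \bigcup_(k in A) c @^-1` [set k]).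
  by apply: fin_bigcup_measurable => //; exact: finite_finset.
by apply/seteqP; split=> [x Ax|x [k Ak /= ck]]; [exists (c x)|rewrite /= ck].
Qed.

Lemma measurable_fun_code (K : finType) (c : X -> K) d' (S : measurableType d') (g : K -> S) :
  measurable_code c -> measurable_fun setT (g \o c).
Proof.
by move=> mc _ B mB; rewrite setTI comp_preimage; exact: measurable_code_preimage.
Qed.

Lemma measurable_code_pair (K L : finType) (c : X -> K) (e : X -> L) :
  measurable_code c -> measurable_code e -> measurable_code (fun x => (c x, e x)).
Proof.
move=> mc me [k l]; rewrite (_ : _ @^-1` _ = c @^-1` [set k] `&` e @^-1` [set l]).
  exact: measurableI.
by apply/seteqP; split=> x /= => [[]//|[-> ->]].
Qed.

(** The cell of the partition generated by the first [n] sets of [E] that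
    contains [x]. *)
Definition code_of (E : nat -> set X) n (x : X) : {ffun 'I_n -> bool} :=
  [ffun i : 'I_n => `[< E i x >]].

Lemma measurable_code_of E n : (forall i, measurable (E i)) -> measurable_code (@code_of E n).
Proof.
move=> mE k; rewrite (_ : _ @^-1` _ =
    \bigcap_(i in [set: 'I_n]) (if k i then E i else ~` E i)).
  apply: fin_bigcap_measurable; first exact: finite_finset.
  by move=> i _; case: (k i) => //; exact: measurableC.
apply/seteqP; split=> x /=.
  by move=> cx i _; rewrite -cx ffunE; case: asboolP.
move=> h; apply/ffunP => i; rewrite ffunE; have := h i I.
by case: (k i) => Ex; [exact: asboolT|exact: asboolF].
Qed.

Definition separating (E : nat -> set X) :=
  (forall i, measurable (E i)) /\ forall x y, (forall i, E i x <-> E i y) -> x = y.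

(** Balls with centres in a countable dense set and radii [1/(n+1)] separate
    the points of the Polish space. Interiors are taken because the balls of a
    pseudometric structure need not be open. *)
Lemma standard_borel_separating (R : realType) : standard_borel R X -> exists E, separating E.
Proof.
move=> [Y [f [[hY [S cS dS]] fI mf]]].
have /pcard_geP[g] := cS; have Sg : S `<=` range g by exact: surj.
pose E k := if (unpickle k : option (nat * nat)%type) is Some p
  then f @^-1` (ball (g p.1) p.2.+1%:R^-1)° else set0.
have [h fK hK] := fI.
have inj_f : injective f by exact: can_inj fK.
exists E; split=> [k|x y Exy].
  rewrite /E; case: unpickle => [p|//]; apply/mf; rewrite image_preimage.
    by apply: sub_sigma_algebra; exact: open_interior.
  by apply/seteqP; split=> // z _; exists (h z).
apply: inj_f; apply: contrapT => /eqP fxy.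
have := hY; rewrite ball_hausdorff => /(_ _ _ fxy)[[r1 r2] /= /eqP r12].
have r10 : 0 < r1%:num / 2 :> R by [].
have [n n1] : exists n, n.+1%:R^-1 < r1%:num / 2 :> R.
  have [n _ /(_ n (leqnn n)) ?] := near_infty_natSinv_lt (PosNum r10).
  by exists n.
(* A ball of radius [dl] around a point within [dl / 2] of [f x] contains
   [f x] in its interior and stays within the separating radius of [f x]. *)
pose dl : R := n.+1%:R^-1.
have dl0 : 0 < dl / 2 by rewrite divr_gt0// invr_gt0 ltr0n.
have [s [Os Ss]] : ((ball (f x) (dl / 2))° `&` S) !=set0.
  apply: dS; last exact: open_interior.
  by exists (f x); apply: nbhs_singleton; apply: nbhs_interior; exact: nbhsx_ballx.
have [i _ gi] := Sg _ Ss.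
have := Exy (pickle (i, n)); rewrite /E pickleK /= gi => -[+ _].
have xs : ball (f x) (dl / 2) s := interior_subset Os.
have sx : (ball s dl)° (f x).
  apply: filterS (nbhsx_ballx (f x) _ dl0) => z xz.
  by rewrite (splitr dl); apply: ball_triangle xz; exact: ball_sym.
move=> /(_ sx)/interior_subset; rewrite /= -/dl => sy.
suff : set0 (f y) by [].
rewrite -r12; split; last exact: ballxx.
apply: (@le_ball _ _ _ (dl / 2 + dl)); last exact: ball_triangle sy.
rewrite (splitr r1%:num) lerD// ltW//.
by rewrite (lt_le_trans _ (ltW n1))// ltr_pdivrMr// ltr_pMr// ?ltr1n// invr_gt0 ltr0n.
Qed.

Lemma mem_code_of E n x y : code_of E n x = code_of E n y <-> (forall i, (i < n)%N -> E i x <-> E i y).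
Proof.
split.
  move=> /ffunP h i ni; have := h (Ordinal ni); rewrite !ffunE /=.
  by case: asboolP => Ex; case: asboolP => Ey.
move=> h; apply/ffunP => i; rewrite !ffunE; have [h1 h2] := h i (ltn_ord i).
by case: asboolP => Ex; case: asboolP => Ey //; exfalso; auto.
Qed.

Lemma integral_code (R : realType) (nu : {measure set X -> \bar R}) (K : finType) (c : X -> K) (g : K -> R) :
  measurable_code c -> (forall k, 0 <= g k) ->
  (\int[nu]_x (g (c x))%:E = \sum_k (g k)%:E * nu (c @^-1` [set k]))%E.
Proof.
move=> mc g0; under eq_integral => x _.
  rewrite (_ : (g (c x))%:E = \sum_(k : K) (g k)%:E * (\1_(c @^-1` [set k]) x)%:E)%E; last first.
    rewrite (bigD1 (c x))//= big1 ?adde0 => [|k kc].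
      by rewrite indicE mem_set// mule1.
    by rewrite indicE memNset ?mule0// => /= ck; rewrite ck eqxx in kc.
  over.
rewrite /= ge0_integral_sum//.
- apply: eq_bigr => k _; rewrite ge0_integralZl//=; last 2 first.
  + exact/measurable_EFinP.
  + by rewrite lee_fin.
  by rewrite integral_indic// setIT.
- by move=> k; apply: measurable_funeM; exact/measurable_EFinP.
- by move=> k x _; rewrite mule_ge0// lee_fin.
Qed.

Definition cell_mass (R : realType) (nu : set X -> \bar R) (E : nat -> set X) n
  (k : {ffun 'I_n -> bool}) : R := fine (nu (code_of E n @^-1` [set k])).
Arguments cell_mass {R} nu E n k.

Section nonatomic_codes.
Context (R : realType) (nu : probability X R) (E : nat -> set X).
Hypotheses (sepE : separating E) (hnu : nonatomic nu).

Let mE := sepE.1.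

Lemma bigcap_code_of x : \bigcap_n (code_of E n @^-1` [set code_of E n x]) = [set x].
Proof.
apply/seteqP; split=> [y h|_ -> //]; apply: sepE.2 => i.
by have /mem_code_of := h i.+1 I; apply.
Qed.

Lemma measurable_set1_separating (x : X) : measurable [set x].
Proof.
rewrite -bigcap_code_of; apply: bigcapT_measurable => n.
exact: (measurable_code_of mE).
Qed.

(** A subset of a singleton is empty or the whole singleton, so a singleton of
    positive mass would contradict nonatomicity. *)
Lemma nonatomic_set1 x : nu [set x] = 0%E.
Proof.
apply: contrapT => /eqP nux.
have [|B [_ Bx /andP[B0 Bnux]]] := hnu (measurable_set1_separating x).
  by rewrite lt0e nux measure_ge0.
have [Bx'|nBx] := pselect (B x).
  by move: Bnux; rewrite (_ : B = [set x]) ?ltxx//; apply/seteqP; split=> // _ ->.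
by move: B0; rewrite (_ : B = set0) ?measure0 ?ltxx// -subset0 => y /[dup] By /Bx /= yx; rewrite yx in By.
Qed.

Lemma cell_massE n k : (cell_mass nu E n k)%:E = nu (code_of E n @^-1` [set k]).
Proof. by rewrite fineK// fin_num_measure//; exact: (measurable_code_of mE). Qed.

Lemma cell_mass_ge0 n k : 0 <= cell_mass nu E n k.
Proof. exact: fine_ge0. Qed.

(** The sum is the integral of the mass of the cell of [x], which decreases to
    the mass of [x] itself, and that is zero. *)
Lemma cell_mass_sq_cvg0 : \sum_k cell_mass nu E n k ^+ 2 @[n --> \oo] --> 0.
Proof.
have := @dominated_convergence _ _ _ nu setT measurableT
  (fun n x => (cell_mass nu E n (code_of E n x))%:E) (cst 0%E) (cst 1%E).
case.
- move=> n; apply/measurable_EFinP; apply: (measurable_fun_code (cell_mass nu E n)).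
  exact: (measurable_code_of mE).
- exact: measurable_cst.
- apply/aeW => x _.
  have -> : (fun n => (cell_mass nu E n (code_of E n x))%:E) =
      nu \o (fun n => code_of E n @^-1` [set code_of E n x]).
    by apply/funext => n; rewrite cell_massE.
  rewrite /= -[X in _ --> X](nonatomic_set1 x) -bigcap_code_of.
  apply: nonincreasing_cvg_mu.
  + by rewrite (le_lt_trans (probability_le1 _ _)) ?ltry//; exact: (measurable_code_of mE).
  + by move=> n; exact: (measurable_code_of mE).
  + by rewrite bigcap_code_of; exact: measurable_set1_separating.
  + apply/nonincreasing_seqP => n; apply/subsetPset => y /= /mem_code_of h.
    by apply/mem_code_of => i ni; apply: h; rewrite ltnS ltnW.
- exact: finite_measure_integrable_cst.
- apply/aeW => x n _; rewrite cell_massE gee0_abs// probability_le1//.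
  exact: (measurable_code_of mE).
move=> _ _; rewrite integral_cst// mul0e.
rewrite (_ : [sequence _]_n = fun n => (\sum_k cell_mass nu E n k ^+ 2)%:E); last first.
  apply/funext => n /=; rewrite integral_code//; last exact: cell_mass_ge0.
    by rewrite -sumEFin; apply: eq_bigr => k _; rewrite expr2 EFinM; congr (_ * _)%E; exact/esym/cell_massE.
  exact: (measurable_code_of mE).
by move/fine_cvgP => [].
Qed.

End nonatomic_codes.
End codes.
Arguments cell_mass {d X R} nu E n k.

(** * Mixtures of exponentials and the Laplace functional on finite partitions *)

Section real_lemmas.
Context (R : realType).
Implicit Types (u t q : R).

(** Telescoping. This bound controls every comparison of two products over the
    cells of a partition below. *)
Lemma prod_unit_dist (I : eqType) (s : seq I) (P : pred I) (a b : I -> R) :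
  (forall i, 0 <= a i <= 1) -> (forall i, 0 <= b i <= 1) ->
  `|\prod_(i <- s | P i) a i - \prod_(i <- s | P i) b i| <= \sum_(i <- s | P i) `|a i - b i|.
Proof.
move=> a01 b01; elim: s => [|i s IH]; first by rewrite !big_nil subrr normr0.
rewrite !big_cons; case: ifP => // _.
set x := \prod_(_ <- _ | _) _ in IH *; set y := \prod_(_ <- _ | _) b _ in IH *.
have -> : a i * x - b i * y = (a i - b i) * x + b i * (x - y) by ring.
rewrite (le_trans (ler_normD _ _))// lerD//.
  rewrite normrM ler_piMr// ger0_norm.
    by apply: prodr_ile1 => j _; exact: a01.
  by apply: prodr_ge0 => j _; case/andP: (a01 j).
rewrite normrM (le_trans _ IH)// ler_piMl// ger0_norm; by case/andP: (b01 i).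
Qed.

Lemma expRN_quadratic u : 0 <= u -> `|expR (- u) - (1 - u)| <= u ^+ 2.
Proof.
move=> u0; have u1 : 0 < 1 + u by rewrite ltr_wpDr.
rewrite ger0_norm ?subr_ge0 ?expR_ge1Dx//.
rewrite expRN lerBlDr (@le_trans _ _ (1 + u)^-1)//.
  by rewrite lef_pV2 ?posrE ?expR_gt0// expR_ge1Dx.
rewrite -div1r ler_pdivrMr// -subr_ge0.
have -> : (u ^+ 2 + (1 - u)) * (1 + u) - 1 = u ^+ 3 by ring.
exact: exprn_ge0.
Qed.

Lemma expRN_lip t q r : 0 <= t -> 0 <= q -> 0 <= r ->
  `|expR (- (t * q)) - expR (- (t * r))| <= t * `|q - r|.
Proof.
move=> t0; wlog qr : q r / q <= r => [hw q0 r0|q0 r0].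
  by have [/hw|/ltW/hw] := leP q r; [exact|rewrite distrC (distrC q); exact].
rewrite [X in _ <= _ * X]distrC [X in _ <= _ * X]ger0_norm ?subr_ge0//.
have -> : - (t * r) = - (t * q) - t * (r - q) by ring.
rewrite expRD -{1}(mulr1 (expR _)) -mulrBr ger0_norm; last first.
  rewrite mulr_ge0 ?expR_ge0// subr_ge0 -expR0 ler_expR oppr_le0.
  by rewrite mulr_ge0// subr_ge0.
rewrite (@le_trans _ _ (1 - expR (- (t * (r - q)))))//.
  rewrite ler_piMl//.
    rewrite subr_ge0 -expR0 ler_expR oppr_le0.
    by rewrite mulr_ge0// subr_ge0.
  by rewrite -expR0 ler_expR oppr_le0 mulr_ge0.
by have := expR_ge1Dx (- (t * (r - q))); lra.
Qed.

Lemma expRN01 u : 0 <= u -> 0 <= expR (- u) <= 1.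
Proof. by move=> u0; rewrite expR_ge0/= -expR0 ler_expR oppr_le0. Qed.

Section mixture.
Context (K : finType) (p phi : K -> R).
Hypotheses (p0 : forall k, 0 <= p k) (p1 : \sum_k p k = 1) (phi0 : forall k, 0 <= phi k).

(** The Laplace transform at [q] of the law that puts mass [p k] at [phi k].
    With [p k] the mass of a cell and [phi k] the value on it of a simple
    function [a], this is the integral of [exp (- q a)]. *)
Definition exp_mixture (p phi : K -> R) q : R := \sum_k p k * expR (- (phi k * q)).

Lemma exp_mixture01 q : 0 <= q -> 0 <= exp_mixture p phi q <= 1.
Proof.
move=> q0; apply/andP; split.
  by apply: sumr_ge0 => k _; rewrite mulr_ge0// expR_ge0.
rewrite -p1; apply: ler_sum => k _.
by rewrite ler_piMr//; case/andP: (expRN01 (mulr_ge0 (phi0 k) q0)).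
Qed.

Lemma exp_mixture_lip q r : 0 <= q -> 0 <= r ->
  `|exp_mixture p phi q - exp_mixture p phi r| <= (\sum_k p k * phi k) * `|q - r|.
Proof.
move=> q0 r0; rewrite -sumrB (le_trans (ler_norm_sum _ _ _))// mulr_suml.
apply: ler_sum => k _; rewrite -mulrBr normrM (ger0_norm (p0 k)) -mulrA.
by rewrite ler_wpM2l// expRN_lip.
Qed.

Lemma exp_mixture0 : exp_mixture p phi 0 = 1.
Proof.
by rewrite -p1; apply: eq_bigr => k _; rewrite mulr0 oppr0 expR0 mulr1.
Qed.

Lemma measurable_exp_mixture : measurable_fun setT (exp_mixture p phi : R -> R).
Proof.
apply: measurable_sum => k; apply: measurable_funM => //.
apply: measurableT_comp => //; apply: measurableT_comp => //.
Qed.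
End mixture.

(** Both terms equal [1 - v * \sum_k p k * phi k] up to an error of order [v ^
    2]. Applied to [v = nu (cell)], with the Laplace exponent in the place of
    [phi]: summing [v ^ 2] over the cells gives a vanishing error. *)
Lemma exp_mixture_first_order (K : finType) (p phi : K -> R) (v : R) :
  (forall k, 0 <= p k) -> \sum_k p k = 1 -> (forall k, 0 <= phi k) -> 0 <= v ->
  `|\sum_k p k * expR (- (v * phi k)) - expR (- (v * \sum_k p k * phi k))| <=
    (\sum_k p k * phi k ^+ 2 + (\sum_k p k * phi k) ^+ 2) * v ^+ 2.
Proof.
move=> p0 p1 phi0 v0; set m := \sum_k p k * phi k.
have m0 : 0 <= m by apply: sumr_ge0 => k _; exact: mulr_ge0.
have -> : \sum_k p k * expR (- (v * phi k)) - expR (- (v * m)) =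
   \sum_k p k * (expR (- (v * phi k)) - (1 - v * phi k)) - (expR (- (v * m)) - (1 - v * m)).
  have -> : \sum_k p k * (expR (- (v * phi k)) - (1 - v * phi k)) =
      \sum_k p k * expR (- (v * phi k)) - (\sum_k p k - v * m).
    rewrite /m mulr_sumr -!sumrB; apply: eq_bigr => k _; ring.
  rewrite p1; ring.
rewrite (le_trans (ler_normB _ _))// mulrDl lerD//; last first.
  by rewrite (le_trans (expRN_quadratic _)) ?mulr_ge0// exprMn mulrC.
rewrite (le_trans (ler_norm_sum _ _ _))// mulr_suml ler_sum// => k _.
rewrite normrM (ger0_norm (p0 k)) -mulrA ler_wpM2l// (le_trans (expRN_quadratic _)) ?mulr_ge0//.
by rewrite exprMn mulrC.
Qed.

End real_lemmas.

Section bounded_convergence.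
Context (R : realType) d (T : measurableType d) (P : probability T R).

Lemma bounded_integrable (f : T -> R) (M : R) : measurable_fun setT f ->
  (forall x, `|f x| <= M) -> P.-integrable setT (EFin \o f).
Proof.
move=> mf fM; apply: measurable_bounded_integrable => //.
  by rewrite (le_lt_trans (probability_le1 _ _))// ltry.
exists M; split; first exact: num_real.
by move=> N MN x _ /=; rewrite (le_trans (fM x))// ltW.
Qed.

Lemma Rintegral_bounded_cvg (f_ : nat -> T -> R) (f : T -> R) (M : R) :
  (forall n, measurable_fun setT (f_ n)) -> (forall n x, `|f_ n x| <= M) ->
  (forall x, f_ n x @[n --> \oo] --> f x) ->
  \int[P]_x f_ n x @[n --> \oo] --> \int[P]_x f x.
Proof.
move=> mf_ fM cf.
have mf : measurable_fun setT f by apply: (measurable_fun_cvg mf_) => x _; exact: cf.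
have := @dominated_convergence _ _ _ P setT measurableT
  (fun n x => (f_ n x)%:E) (EFin \o f) (cst M%:E).
case.
- by move=> n; exact/measurable_EFinP.
- exact/measurable_EFinP.
- by apply/aeW => x _; apply: cvg_EFin; [exact: nearW|exact: cf].
- exact: finite_measure_integrable_cst.
- by apply/aeW => x n _; rewrite lee_fin.
move=> intf _ h; apply/fine_cvg; rewrite fineK; first exact: h.
exact: integrable_fin_num.
Qed.

End bounded_convergence.

Section laplace.
Context (R : realType) d (X : measurableType d).

Lemma Rintegral_code (mu : {finite_measure set X -> \bar R}) (K : finType) (c : X -> K)
  (g : K -> R) : measurable_code c -> (forall k, 0 <= g k) ->
  \int[mu]_x g (c x) = \sum_k g k * fine (mu (c @^-1` [set k])).
Proof.
move=> mc g0; rewrite /Rintegral integral_code//.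
rewrite (_ : (\sum_k _)%E = (\sum_k g k * fine (mu (c @^-1` [set k])))%:E)//.
rewrite -sumEFin; apply: eq_bigr => k _; rewrite EFinM fineK//.
by rewrite fin_num_measure.
Qed.

Context (Lambda : {measure set (measurableTypeR R) -> \bar R}).

(** The Lévy-Khintchine exponent, the integral of [1 - exp (- t s)] against
    [Lambda]. *)
Definition laplace_exponent t := - ln (psi Lambda t).

Lemma laplace_exponent_ge0 t : 0 <= t -> 0 <= laplace_exponent t.
Proof.
move=> t0; rewrite /laplace_exponent /psi expRK opprK; apply: Rintegral_ge0 => s /=.
rewrite in_itv/= andbT => s0; rewrite subr_ge0 -expR0 ler_expR oppr_le0.
by rewrite mulr_ge0// ltW.
Qed.

Context (nu : probability X R) (P : probability (dplus_space R X) R).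
Hypothesis hP : levy_law nu Lambda P.

(** The defining Laplace functional for a simple function, written on the
    atoms of a finite partition: the masses of disjoint sets are independent. *)
Lemma levy_code (K : finType) (c : X -> K) (phi : K -> R) : measurable_code c ->
  (forall k, 0 <= phi k) ->
  \int[P]_eta expR (- \sum_k phi k * fine ((eta : dplus R X) (c @^-1` [set k]))) =
  expR (- \sum_k fine (nu (c @^-1` [set k])) * laplace_exponent (phi k)).
Proof.
move=> mc phi0.
have bd : exists M, forall x, (phi \o c) x <= M.
  exists (\sum_k phi k) => x; rewrite (bigD1 (c x))//= lerDl.
  by apply: sumr_ge0 => k _.
have := hP (measurable_fun_code phi mc) (fun x => phi0 (c x)) bd.
under eq_Rintegral do rewrite (Rintegral_code _ mc phi0).
move=> ->; congr expR.
rewrite -[LHS]opprK; congr (- _).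
have -> : \int[nu]_x ln (psi Lambda ((phi \o c) x)) = \int[nu]_x (-1 * laplace_exponent (phi (c x))).
  by apply: eq_Rintegral => x _; rewrite /laplace_exponent mulN1r opprK.
have lc : measurable_fun setT (fun x => laplace_exponent (phi (c x))).
  exact: (measurable_fun_code (fun k => laplace_exponent (phi k)) mc).
rewrite RintegralZl//; last first.
  apply: (@bounded_integrable _ _ _ nu _ (\sum_k laplace_exponent (phi k))) => // x.
  rewrite ger0_norm ?laplace_exponent_ge0// (bigD1 (c x))//= lerDl.
  by apply: sumr_ge0 => k _; exact: laplace_exponent_ge0.
rewrite mulN1r opprK (Rintegral_code nu (g := fun k => laplace_exponent (phi k)) mc)//.
  by apply: eq_bigr => k _; rewrite mulrC.
by move=> k; exact: laplace_exponent_ge0.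
Qed.

End laplace.

(** * Products over cells approximate products over atoms *)

Section partial_atoms.
Context (R : realType) d (X : measurableType d).
Implicit Types (eta : dplus R X) (q : nat -> R) (x : nat -> X) (A : set X).

Definition partial_atoms q x m A : R := \sum_(i < m) q i * \1_A (x i).

Lemma partial_atoms_ge0 q x m A : (forall i, 0 <= q i) -> 0 <= partial_atoms q x m A.
Proof. by move=> q0; apply: sumr_ge0 => i _; rewrite mulr_ge0// indicE. Qed.

Lemma partial_atomsE q x m A :
  (partial_atoms q x m A)%:E = (\sum_(0 <= i < m) (q i)%:E * \d_(x i) A)%E.
Proof.
rewrite big_mkord -sumEFin; apply: eq_bigr => i _.
by rewrite EFinM diracE indicE.
Qed.

Context eta (q : nat -> R) (x : nat -> X).
Hypotheses (q0 : forall i, 0 <= q i) (etaE : forall A, eta A = atomic_sum q x A).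

Lemma eta_fin A : measurable A -> eta A \is a fin_num.
Proof. by move=> mA; rewrite fin_num_measure. Qed.

Lemma partial_atoms_le m A : measurable A -> partial_atoms q x m A <= fine (eta A).
Proof.
move=> mA; rewrite -lee_fin fineK ?eta_fin// partial_atomsE etaE.
by apply: nneseries_lim_ge => i _ _; rewrite mule_ge0// lee_fin.
Qed.

Lemma partial_atoms_cvg A : measurable A -> partial_atoms q x m A @[m --> \oo] --> fine (eta A).
Proof.
move=> mA; suff : (fun m => (partial_atoms q x m A)%:E) @ \oo --> (fine (eta A))%:E by move/fine_cvg.
rewrite fineK ?eta_fin// etaE.
rewrite (_ : (fun m => _) = (fun m => \sum_(0 <= i < m) (q i)%:E * \d_(x i) A)%E); last first.
  by apply/funext => m; rewrite partial_atomsE.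
by apply: is_cvg_nneseries => i _ _; rewrite mule_ge0// lee_fin.
Qed.

End partial_atoms.

Section cells_product.
Context (R : realType) d (X : measurableType d) (E : nat -> set X).
Hypothesis sepE : separating E.
Context (eta : dplus R X) (q : conic_seq R) (x : nat -> X).
Hypothesis etaqx : ordered_atoms eta q x.
Context (K : finType) (p phi : K -> R).
Hypotheses (p0 : forall k, 0 <= p k) (p1 : \sum_k p k = 1) (phi0 : forall k, 0 <= phi k).

Let L := exp_mixture p phi.
Let q0 := @charge_of_ge0 R q.

Lemma code_of_separates m : \forall n \near \oo, forall i j : 'I_m,
  x i <> x j -> code_of E n (x i) <> code_of E n (x j).
Proof.
apply: filter_forall => i; apply: filter_forall => j.
have [xij|nxij] := pselect (x i = x j); first by apply: nearW.
have [l hl] : exists l, ~ (E l (x i) <-> E l (x j)).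
  apply: contrapT => /forallNP h; apply: nxij; apply: sepE.2 => l.
  by apply: contrapT; exact: h.
exists l.+1 => // n /= ln _ /mem_code_of h; apply: hl; exact: h.
Qed.

(** Once the partition separates the distinct positions among the first [m],
    each cell contains at most one charged atom; atoms of charge zero and
    cells without atoms contribute a factor [L 0 = 1]. *)
Lemma prod_cells_partial m : \forall n \near \oo,
  \prod_k L (partial_atoms q x m (code_of E n @^-1` [set k])) = \prod_(i < m) L (q i).
Proof.
near=> n.
have sep : forall i j : 'I_m, x i <> x j -> code_of E n (x i) <> code_of E n (x j).
  by near: n; exact: code_of_separates.
rewrite [RHS](partition_big (fun i : 'I_m => code_of E n (x i)) xpredT)//=.
apply: eq_bigr => k _.
have -> : partial_atoms q x m (code_of E n @^-1` [set k]) =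
    \sum_(i < m | code_of E n (x i) == k) q i.
  rewrite [RHS]big_mkcond; apply: eq_bigr => i _; rewrite indicE.
  case: ifPn => /eqP h; first by rewrite mem_set// mulr1.
  by rewrite memNset// mulr0.
(* A cell with a charged atom [i0] contains no other charged atom; otherwise
   all atoms in the cell have charge zero. *)
have [[i0 /eqP ci0 qi0]|nex] :=
    pselect (exists2 i0 : 'I_m, code_of E n (x i0) == k & 0 < q i0).
  have z (i : 'I_m) : (code_of E n (x i) == k) && (i != i0) -> q i = 0.
    move=> /andP[/eqP ci ii0]; apply/eqP; apply: contraNT ii0 => qi.
    apply/eqP/val_inj; apply: etaqx.2 => //; first by rewrite lt0r qi q0.
    by apply: contrapT => /sep; rewrite ci ci0.
  rewrite (bigD1 i0) ?ci0//= big1// addr0 (bigD1 i0) ?ci0//= big1 ?mulr1//.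
  by move=> i /z ->; exact: exp_mixture0.
have z (i : 'I_m) : code_of E n (x i) == k -> q i = 0.
  move=> ci; apply/eqP; apply: contrapT => /negP qi; apply: nex; exists i => //.
  by rewrite lt0r qi q0.
by rewrite big1// /L exp_mixture0// big1// => i /z ->; exact: exp_mixture0.
Unshelve. all: by end_near. Qed.

Let mcell n k : measurable (code_of E n @^-1` [set k]).
Proof. exact: (measurable_code_of sepE.1). Qed.

(** [L] is Lipschitz, and the total mass that the tail of the atoms puts on
    the cells does not depend on the partition. *)
Lemma prod_cells_dist n m :
  `|\prod_k L (fine (eta (code_of E n @^-1` [set k]))) -
    \prod_k L (partial_atoms q x m (code_of E n @^-1` [set k]))| <=
  (\sum_k p k * phi k) * (fine (eta setT) - partial_atoms q x m setT).
Proof.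
have h0 := partial_atoms_ge0 x _ _ q0.
rewrite (le_trans (prod_unit_dist _ _ _ _))//.
- by move=> k; apply: exp_mixture01 => //; exact: fine_ge0.
- by move=> k; exact: exp_mixture01.
have -> : fine (eta setT) - partial_atoms q x m setT =
  \sum_k `|fine (eta (code_of E n @^-1` [set k])) - partial_atoms q x m (code_of E n @^-1` [set k])|.
  under eq_bigr => k _.
    rewrite ger0_norm; last by rewrite subr_ge0 (partial_atoms_le q0 etaqx.1).
    over.
  rewrite sumrB; congr (_ - _).
    have := Rintegral_code eta (g := cst 1) (@measurable_code_of _ _ E n sepE.1) (fun=> ler01).
    rewrite /= Rintegral_cst// mul1r => ->.
    by apply: eq_bigr => k _; rewrite mul1r.
  rewrite /partial_atoms exchange_big/=; apply: eq_bigr => i _.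
  rewrite -mulr_sumr indicT mulr1 (bigD1 (code_of E n (x i)))//= big1 ?addr0.
    by rewrite indicE mem_set// mulr1.
  by move=> k /eqP kc; rewrite indicE memNset// => /esym.
rewrite mulr_sumr; by apply: ler_sum => k _; apply: exp_mixture_lip => //; exact: fine_ge0.
Qed.

(** The charges of the atoms are recovered from the masses of the cells:
    choose [m] so that the atoms of index at least [m] are negligible, then a
    partition that separates the first [m]. *)
Lemma prod_cells_cvg (W : R) : \prod_(i < m) L (q i) @[m --> \oo] --> W ->
  \prod_k L (fine (eta (code_of E n @^-1` [set k]))) @[n --> \oo] --> W.
Proof.
move=> cW; set C := \sum_k p k * phi k.
have ct : C * (fine (eta setT) - partial_atoms q x m setT) @[m --> \oo] --> 0.
  rewrite -[X in _ --> X](mulr0 C) -(subrr (fine (eta setT))).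
  apply: cvgM; [exact: cvg_cst|apply: cvgB; [exact: cvg_cst|]].
  exact: (partial_atoms_cvg q0 etaqx.1).
apply/cvgrPdist_lt => e e0; have e2 : 0 < e / 2 by rewrite divr_gt0.
have [m [hm1 hm2]] : exists m, `|W - \prod_(i < m) L (q i)| < e / 2 /\
    C * (fine (eta setT) - partial_atoms q x m setT) < e / 2.
  have : \forall m \near \oo, `|W - \prod_(i < m) L (q i)| < e / 2 /\
    C * (fine (eta setT) - partial_atoms q x m setT) < e / 2.
    near=> m; split; near: m; first by move/cvgrPdist_lt : cW; exact.
    by move: ct => /cvgr_lt; exact.
  by move=> [m _ /(_ m (leqnn m))]; exists m.
near=> n.
have hn : \prod_k L (partial_atoms q x m (code_of E n @^-1` [set k])) = \prod_(i < m) L (q i).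
  by near: n; exact: prod_cells_partial.
have := prod_cells_dist n m; rewrite hn => h.
rewrite (splitr e) (le_lt_trans (ler_distD (\prod_(i < m) L (q i)) _ _))// ltrD//.
by rewrite distrC (le_lt_trans h).
Unshelve. all: by end_near. Qed.

Lemma prod_charges_cvg : cvgn (fun m => \prod_(i < m) L (q i)).
Proof.
apply: nonincreasing_is_cvgn.
  apply/nonincreasing_seqP => m; rewrite big_ord_recr/= ler_piMr//.
    by apply: prodr_ge0 => i _; case/andP : (exp_mixture01 p0 p1 phi0 (q0 i)).
  by case/andP : (exp_mixture01 p0 p1 phi0 (q0 m)).
exists 0 => _ [m _ <-].
by apply: prodr_ge0 => i _; case/andP : (exp_mixture01 p0 p1 phi0 (q0 i)).
Qed.

End cells_product.

(** * Expectation of a product over cells *)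

Section evaluations.
Context (R : realType) d (X : measurableType d).

Lemma measurable_evaluation (A : set X) : measurable A ->
  measurable_fun setT (fun eta : dplus_space R X => (eta : dplus R X) A).
Proof.
move=> mA _ B mB; rewrite setTI; apply: sub_sigma_algebra; exists A => //.
by exists B => //; rewrite setTI.
Qed.

Lemma measurable_fine_evaluation (A : set X) : measurable A ->
  measurable_fun setT (fun eta : dplus_space R X => fine ((eta : dplus R X) A)).
Proof. by move=> mA; apply: measurableT_comp => //; exact: measurable_evaluation. Qed.

End evaluations.

Lemma Rintegral_sum (R : realType) d (T : measurableType d) (P : probability T R)
    (I : eqType) (s : seq I) (f : I -> T -> R) :
  (forall i, P.-integrable setT (EFin \o f i)) ->
  \int[P]_x (\sum_(i <- s) f i x) = \sum_(i <- s) \int[P]_x f i x.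
Proof.
move=> If; elim: s => [|i s IH].
  rewrite big_nil; under eq_Rintegral do rewrite big_nil.
  by rewrite Rintegral_cst// mul0r.
rewrite big_cons -IH -RintegralD//.
  by apply: eq_Rintegral => x _; rewrite big_cons.
rewrite (_ : _ \o _ = fun x => (\sum_(j <- s) (f j x)%:E)%E).
  by apply: integrable_sum => // j _; exact: If.
by apply/funext => x /=; rewrite sumEFin.
Qed.

Section expected_product.
Context (R : realType) d (X : measurableType d) (nu : probability X R).
Context (Lambda : {measure set (measurableTypeR R) -> \bar R}).
Context (P : probability (dplus_space R X) R).
Hypothesis hP : levy_law nu Lambda P.
Context (E : nat -> set X).
Hypothesis sepE : separating E.
Context (K : finType) (p phi : K -> R).
Hypotheses (p0 : forall k, 0 <= p k) (p1 : \sum_k p k = 1) (phi0 : forall k, 0 <= phi k).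

Let mcell n : measurable_code (@code_of _ _ E n).
Proof. exact: (measurable_code_of sepE.1). Qed.

Definition cells_product n (eta : dplus_space R X) : R :=
  \prod_k exp_mixture p phi (fine ((eta : dplus R X) (code_of E n @^-1` [set k]))).

Lemma measurable_cells_product n : measurable_fun setT (cells_product n).
Proof.
apply: measurable_prod => k _.
by apply: measurableT_comp; [exact: measurable_exp_mixture|exact: (measurable_fine_evaluation (@mcell _ _))].
Qed.

Lemma cells_product01 n eta : 0 <= cells_product n eta <= 1.
Proof.
have h k := exp_mixture01 p0 p1 phi0 (fine_ge0 (measure_ge0 (eta : dplus R X) (code_of E n @^-1` [set k]))).
apply/andP; split; first by apply: prodr_ge0 => k _; have /andP[] := h k.
by apply: prodr_ile1 => k _; exact: h.
Qed.

Let p_le1 l : p l <= 1.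
Proof. by rewrite -p1 (bigD1 l)//= lerDl; apply: sumr_ge0 => i _. Qed.

Let fine_eta_ge0 (eta : dplus_space R X) A : 0 <= fine ((eta : dplus R X) A).
Proof. exact: fine_ge0. Qed.

(** Expanding the product of sums turns the expectation into Laplace
    transforms on the partition, each of which factors over the cells; the sum
    is then folded back into a product. *)
Lemma expected_cells_product n : \int[P]_eta cells_product n eta =
  \prod_k \sum_l p l * expR (- (cell_mass nu E n k * laplace_exponent Lambda (phi l))).
Proof.
rewrite /cells_product /exp_mixture.
under eq_Rintegral do rewrite bigA_distr_bigA.
have pe01 eta A l : 0 <= expR (- (phi l * fine ((eta : dplus R X) A))) <= 1.
  exact/expRN01/mulr_ge0.
have me (g : {ffun {ffun 'I_n -> bool} -> K}) k : measurable_fun setT (fun eta : dplus_space R X =>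
    expR (- (phi (g k) * fine ((eta : dplus R X) (code_of E n @^-1` [set k]))))).
  apply: measurableT_comp => //; apply: measurableT_comp => //.
  by apply: measurable_funM => //; exact: (measurable_fine_evaluation (@mcell _ _)).
rewrite [RHS]bigA_distr_bigA/= Rintegral_sum; last first.
  move=> f; apply: (@bounded_integrable _ _ _ P _ 1).
    by apply: measurable_prod => k _; apply: measurable_funM.
  move=> eta; have h k : 0 <= p (f k) * expR (- (phi (f k) * fine ((eta : dplus R X) (code_of E n @^-1` [set k])))) <= 1.
    have /andP[e0 e1] := pe01 eta (code_of E n @^-1` [set k]) (f k).
    by rewrite mulr_ge0//= mulr_ile1.
  rewrite ger0_norm; first by apply: prodr_ile1 => k _; exact: h.
  by apply: prodr_ge0 => k _; have /andP[] := h k.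
apply: eq_bigr => f _.
under eq_Rintegral do rewrite big_split/=.
rewrite big_split/= RintegralZl//; last first.
  apply: (@bounded_integrable _ _ _ P _ 1).
    by apply: measurable_prod => k _.
  move=> eta; rewrite ger0_norm; first by apply: prodr_ile1 => k _; exact: pe01.
  by apply: prodr_ge0 => k _; exact: expR_ge0.
congr (_ * _).
under eq_Rintegral do rewrite -expR_sum sumrN.
by rewrite (levy_code hP (@mcell n) (fun k => phi0 (f k))) -expR_sum sumrN.
Qed.

Lemma sum_cell_mass n : \sum_k cell_mass nu E n k = 1.
Proof.
have := Rintegral_code nu (g := cst 1) (@mcell n) (fun=> ler01).
rewrite /= Rintegral_cst//= (@probability_setT _ _ _ nu) mulr1 => ->.
by apply: eq_bigr => k _; rewrite mul1r.
Qed.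

Hypothesis hnu : nonatomic nu.

(** The factor of a cell of mass [v] is [exp (- v * m)] up to an error of
    order [v ^ 2], where [m] is the mixture of the Laplace exponents. The
    factors [exp (- v * m)] multiply to [exp (- m)] because the masses of the
    cells add up to one. *)
Lemma expected_cells_product_cvg : \int[P]_eta cells_product n eta @[n --> \oo] -->
  expR (- \sum_l p l * laplace_exponent Lambda (phi l)).
Proof.
have l0 l : 0 <= laplace_exponent Lambda (phi l) by exact: laplace_exponent_ge0.
set m := \sum_l p l * laplace_exponent Lambda (phi l).
set C := (\sum_l p l * laplace_exponent Lambda (phi l) ^+ 2 + m ^+ 2).
have m0 : 0 <= m by apply: sumr_ge0 => l _; exact: mulr_ge0.
have c0 n k : 0 <= cell_mass nu E n k by exact: fine_ge0.
have bound n : `|expR (- m) - \int[P]_eta cells_product n eta| <=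
    C * \sum_k cell_mass nu E n k ^+ 2.
  have -> : expR (- m) = \prod_k expR (- (cell_mass nu E n k * m)).
    by rewrite -expR_sum sumrN -mulr_suml sum_cell_mass mul1r.
  rewrite expected_cells_product distrC (le_trans (prod_unit_dist _ _ _ _))//.
  - move=> k; have := exp_mixture01 p0 p1 l0 (c0 n k); rewrite /exp_mixture.
    by under eq_bigr do rewrite mulrC [X in expR (- X)]mulrC mulrC.
  - by move=> k; apply/expRN01/mulr_ge0.
  rewrite mulr_sumr; apply: ler_sum => k _; exact: exp_mixture_first_order.
have b0 : C * \sum_k cell_mass nu E n k ^+ 2 @[n --> \oo] --> 0.
  rewrite -[X in _ --> X](mulr0 C); apply: cvgM; first exact: cvg_cst.
  exact: cell_mass_sq_cvg0.
apply/cvgrPdist_lt => e e0; near=> n.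
rewrite (le_lt_trans (bound n))//; near: n.
by move: b0 => /cvgr_lt; exact.
Unshelve. all: by end_near. Qed.

End expected_product.

(** * Expectation of a product over the charges *)

Lemma Rintegral_prod_fst (R : realType) d1 d2 (T1 : measurableType d1) (T2 : measurableType d2)
  (P : probability T1 R) (U : probability T2 R) (g : T1 -> R) :
  measurable_fun setT g -> (forall x, 0 <= g x) ->
  \int[(P \x U)%E]_z g z.1 = \int[P]_x g x.
Proof.
move=> mg g0; rewrite /Rintegral fubini_tonelli1/=.
- congr fine; apply: eq_integral => x _; rewrite /fubini_F/= integral_cst//.
  by rewrite [X in (_ * X)%E]probability_setT mule1.
- by apply/measurable_EFinP; exact: measurableT_comp.
- by move=> z; rewrite lee_fin.
Qed.

Lemma Rintegral_distribution (R : realType) d1 d2 (T1 : measurableType d1) (T2 : measurableType d2)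
  (P : probability T1 R) (f : {mfun T1 >-> T2}) (g : T2 -> R) :
  measurable_fun setT g -> (forall x, 0 <= g x) ->
  \int[distribution P f]_y g y = \int[P]_x g (f x).
Proof.
move=> mg g0; rewrite /Rintegral ge0_integral_distribution//.
  exact/measurable_EFinP.
Qed.

Lemma measurable_charge (R : realType) i :
  measurable_fun setT (fun q : conic_space R => (q : conic_seq R) i : R).
Proof.
move=> _ B mB; apply: sub_sigma_algebra; exists i => //.
by exists B.
Qed.

Section charge_product.
Context (R : realType) d (X : measurableType d) (nu : probability X R).
Context (Lambda : {measure set (measurableTypeR R) -> \bar R}).
Context (P : probability (dplus_space R X) R).
Hypothesis hP : levy_law nu Lambda P.
Hypotheses (hX : standard_borel R X) (hnu : nonatomic nu).
Context d' (W : measurableType d') (U : probability W R)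
    (T : {mfun (dplus_space R X * W)%type >-> (conic_space R * seq_space X)%type}).
Hypothesis hT : ordering_map T.
Context (K : finType) (p phi : K -> R).
Hypotheses (p0 : forall k, 0 <= p k) (p1 : \sum_k p k = 1) (phi0 : forall k, 0 <= phi k).

Let Pr : probability (dplus_space R X * W)%type R := (P \x U)%E.

Definition charge_product m (q : conic_space R) : R :=
  \prod_(i < m) exp_mixture p phi ((q : conic_seq R) i).

Lemma measurable_charge_product m : measurable_fun setT (charge_product m).
Proof.
apply: measurable_prod => k _.
by apply: measurableT_comp; [exact: measurable_exp_mixture|exact: measurable_charge].
Qed.

Lemma charge_product01 m q : 0 <= charge_product m q <= 1.
Proof.
have h i := exp_mixture01 p0 p1 phi0 (@charge_of_ge0 R (q : conic_seq R) i).
apply/andP; split; first by apply: prodr_ge0 => i _; have /andP[] := h i.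
by apply: prodr_ile1 => i _; exact: h.
Qed.

(** The generating functional of the charges, obtained from the Laplace
    functional alone: along refining partitions the products over cells
    converge pointwise to the product over all charges, and their expectations
    converge to the right-hand side. *)
Lemma expected_charge_product_cvg :
  \int[distribution Pr (charges T)]_q charge_product m q @[m --> \oo] -->
  expR (- \sum_l p l * laplace_exponent Lambda (phi l)).
Proof.
have [E sepE] := standard_borel_separating hX.
have cp m q : 0 <= charge_product m q by case/andP: (charge_product01 m q).
rewrite (_ : (fun m => _) = (fun m => \int[Pr]_om charge_product m (charges T om))); last first.
  by apply/funext => m; rewrite Rintegral_distribution//; exact: measurable_charge_product.
pose w om := limn (fun m => charge_product m (charges T om)).
have cw om : charge_product m (charges T om) @[m --> \oo] --> w om.
  exact: (prod_charges_cvg (q := charges T om) p0 p1 phi0).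
have cc om : cells_product E p phi n om.1 @[n --> \oo] --> w om.
  have otom : ordered_atoms om.1 (T om).1 (T om).2 by case: om => eta u; exact: hT.
  exact: (prod_cells_cvg sepE otom p0 p1 phi0 (cw om)).
have h1 : \int[Pr]_om charge_product m (charges T om) @[m --> \oo] --> \int[Pr]_om w om.
  apply: (@Rintegral_bounded_cvg _ _ _ _ _ _ 1) => //.
    by move=> m; apply: measurableT_comp; [exact: measurable_charge_product|exact: measurable_charges].
  by move=> m om; rewrite ger0_norm//; case/andP: (charge_product01 m (charges T om)).
have h2 : \int[Pr]_om cells_product E p phi n om.1 @[n --> \oo] --> \int[Pr]_om w om.
  apply: (@Rintegral_bounded_cvg _ _ _ _ _ _ 1) => //.
    by move=> m; apply: measurableT_comp => //; exact: measurable_cells_product.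
  move=> m om; have /andP[c0 c1] := cells_product01 E p0 p1 phi0 m om.1.
  by rewrite ger0_norm.
have h3 := expected_cells_product_cvg hP sepE p0 p1 phi0 hnu.
suff <- : \int[Pr]_om w om = expR (- \sum_l p l * laplace_exponent Lambda (phi l)) by [].
apply: (cvg_unique _ h2).
  exact: Rhausdorff.
rewrite (_ : (fun n => _) = (fun n => \int[P]_eta cells_product E p phi n eta))//.
apply/funext => n; rewrite Rintegral_prod_fst//; first exact: measurable_cells_product.
by move=> eta; case/andP: (cells_product01 E p0 p1 phi0 n eta).
Qed.

End charge_product.

(** * The measure with resampled positions *)

Section atomic_measure.
Context (R : realType) d (X : measurableType d).
Context (q : conic_seq R) (x : nat -> X).

Let q0 i : 0 <= q i := @charge_of_ge0 R q i.

Definition atomic_measure : set X -> \bar R :=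
  mseries (fun i => mscale (NngNum (q0 i)) (\d_(x i))) 0.

HB.instance Definition _ := Measure.on atomic_measure.

Lemma atomic_measureE A : atomic_measure A = atomic_sum q x A.
Proof. by []. Qed.

Let atomic_measure_fin : fin_num_fun atomic_measure.
Proof.
move=> A mA; rewrite ge0_fin_numE// atomic_measureE.
apply: (@le_lt_trans _ _ (\sum_(0 <= i <oo) (q i)%:E)%E).
  apply: lee_nneseries => i _; first by move=> _; rewrite mule_ge0// lee_fin.
  by rewrite /= /mscale/= diracE; case: (_ \in _); rewrite ?mule1// mule0 lee_fin.
have /cvg_ex[/= l ql] := @charge_of_summable R q.
rewrite (_ : (\sum_(0 <= i <oo) (q i)%:E)%E = l%:E) ?ltry//.
apply/cvg_lim => //.
rewrite (_ : (fun n => _) = EFin \o series q).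
  by apply: cvg_EFin; [exact: nearW|exact: ql].
by apply/funext => n; rewrite /series/= sumEFin.
Qed.

HB.instance Definition _ := Measure_isFinite.Build _ _ _ atomic_measure atomic_measure_fin.

Lemma atomic_measure_discrete : exists (q : nat -> R) (x : nat -> X),
  (forall i, 0 <= q i) /\ (forall A : set X, atomic_measure A = atomic_sum q x A).
Proof. by exists q, x; split. Qed.

Definition atomic : dplus R X := DPlus (atomic_measure_discrete).

End atomic_measure.

Section resampled.
Context (R : realType) d (X : measurableType d).

(** The measure with given charges and given positions. Applied to charges of
    law kappa and independent positions of law [nu^oo], it yields the
    resampled measure. *)
Definition assemble (z : (conic_space R * seq_space X)%type) : dplus_space R X :=
  atomic (z.1 : conic_seq R) (z.2 : nat -> X).

Lemma measurable_to_dplus d' (S : measurableType d') (f : S -> dplus_space R X) :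
  (forall A, measurable A -> measurable_fun setT (fun s => (f s : dplus R X) A)) ->
  measurable_fun setT f.
Proof.
move=> mf; refine (@measurability _ _ S (dplus_space R X) setT f
  (\bigcup_(A in [set A : set X | measurable A])
       preimage_set_system setT (@evaluation R d X A)
         (measurable : set (set (\bar R)))) _ _) => //.
move=> _ [_ [A mA [B mB <-]] <-]; rewrite setTI.
by have := mf A mA measurableT B mB; rewrite !setTI.
Qed.

Lemma measurable_coord_mem A i : measurable A ->
  measurable_fun setT (fun x : seq_space X => \d_((x : nat -> X) i) A : \bar R).
Proof.
move=> mA; exact: (measurableT_comp (measurable_fun_dirac (D := setT) mA) (@measurable_coord d X i)).
Qed.

Lemma measurable_assemble : measurable_fun setT assemble.
Proof.
apply: measurable_to_dplus => A mA.
rewrite (_ : (fun s => _) = fun z : (conic_space R * seq_space X)%type =>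
  (\sum_(i <oo | i \in predT) ((z.1 : conic_seq R) i)%:E * \d_((z.2 : nat -> X) i) A)%E)//.
apply: ge0_emeasurable_sum => [i z _ _|i _].
  by rewrite mule_ge0// lee_fin; exact: charge_of_ge0.
apply: emeasurable_funM.
  by apply/measurable_EFinP; exact: (measurableT_comp (@measurable_charge R i) measurable_fst).
exact: (measurableT_comp (measurable_coord_mem i mA) measurable_snd).
Qed.

HB.instance Definition _ := isMeasurableFun.Build _ _ _ _ assemble measurable_assemble.

End resampled.

Section resampled_laplace.
Context (R : realType) d (X : measurableType d) (nu : probability X R).
Context (rho : probability (seq_space X) R) (kappa : probability (conic_space R) R).
Hypothesis hrho : infinite_power nu rho.
Context (K : finType) (c : X -> K).
Hypothesis mc : measurable_code c.

Definition seq_code m (y : seq_space X) : {ffun 'I_m -> K} := [ffun i : 'I_m => c ((y : nat -> X) i)].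

Let seq_code_box m (f : {ffun 'I_m -> K}) : seq_code m @^-1` [set f] =
  box m (fun i => if insub i is Some j then c @^-1` [set f j] else setT).
Proof.
apply/seteqP; split=> y /=.
  by move=> yf i im; rewrite insubT /= -yf ffunE.
move=> h; apply/ffunP => i; rewrite ffunE; have := h i (ltn_ord i).
by rewrite valK.
Qed.

Let mbox m (f : {ffun 'I_m -> K}) i :
  measurable (if insub i is Some j then c @^-1` [set f j] else setT).
Proof. by case: insub => [j|//]; exact: mc. Qed.

Lemma measurable_seq_code m : measurable_code (seq_code m).
Proof. by move=> f; rewrite seq_code_box; exact: measurable_box. Qed.

(** Independence of the coordinates, for functions of finitely many values:
    the vector of the codes of the first [m] coordinates is itself a finite
    code, whose cells are boxes. *)
Lemma Rintegral_power_prod m (g : 'I_m -> K -> R) : (forall i k, 0 <= g i k) ->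
  \int[rho]_y \prod_i g i (c ((y : nat -> X) (i : 'I_m))) =
  \prod_i \sum_k fine (nu (c @^-1` [set k])) * g i k.
Proof.
move=> g0; pose G (f : {ffun 'I_m -> K}) := \prod_i g i (f i).
have -> : \int[rho]_y \prod_i g i (c ((y : nat -> X) (i : 'I_m))) =
    \int[rho]_y G (seq_code m y).
  by apply: eq_Rintegral => y _; apply: eq_bigr => i _; rewrite ffunE.
rewrite (Rintegral_code rho (g := G) (@measurable_seq_code m)); last first.
  by move=> f; apply: prodr_ge0 => i _.
rewrite bigA_distr_bigA; apply: eq_bigr => f _.
rewrite big_split/= mulrC; congr (_ * _).
rewrite /= seq_code_box hrho//.
rewrite (_ : (\prod_(i < m) _)%E = (\prod_(i < m) fine (nu (c @^-1` [set f i])))%:E)//.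
rewrite -prodEFin; apply: eq_bigr => i _; rewrite valK fineK//.
by rewrite fin_num_measure.
Qed.

Context (phi : K -> R).
Hypothesis phi0 : forall k, 0 <= phi k.

Let p k := fine (nu (c @^-1` [set k])).

Lemma partial_atoms_code (q : nat -> R) (y : nat -> X) m :
  \sum_k phi k * partial_atoms q y m (c @^-1` [set k]) = \sum_(i < m) phi (c (y i)) * q i.
Proof.
under eq_bigr do rewrite mulr_sumr.
rewrite exchange_big/=; apply: eq_bigr => i _.
rewrite (bigD1 (c (y i)))//= big1 ?addr0.
  by rewrite indicE mem_set// mulr1.
by move=> k /eqP kc; rewrite indicE memNset ?mulr0// => /esym.
Qed.

(** Given the charges, the positions are iid, so that integrating them out
    leaves one factor [exp_mixture p phi (q i)] for each charge. *)
Lemma resampled_laplace : \int[kappa]_q charge_product p phi m q @[m --> \oo] -->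
  \int[distribution (kappa \x rho)%E (@assemble R d X)]_eta
    expR (- \sum_k phi k * fine ((eta : dplus R X) (c @^-1` [set k]))).
Proof.
have mexp : measurable_fun setT (fun eta : dplus_space R X =>
    expR (- \sum_k phi k * fine ((eta : dplus R X) (c @^-1` [set k])))).
  apply: measurableT_comp => //; apply: measurableT_comp => //.
  apply: measurable_sum => k; apply: measurable_funM => //.
  exact: (measurable_fine_evaluation (mc k)).
rewrite Rintegral_distribution//.
pose F m (z : (conic_space R * seq_space X)%type) : R :=
  \prod_(i < m) expR (- (phi (c ((z.2 : nat -> X) i)) * (z.1 : conic_seq R) i)).
have q0 (q : conic_space R) i : 0 <= (q : conic_seq R) i by exact: charge_of_ge0.
have mF m : measurable_fun setT (F m).
  apply: measurable_prod => i _; apply: measurableT_comp => //; apply: measurableT_comp => //.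
  apply: measurable_funM; last exact: (measurableT_comp (@measurable_charge R i) measurable_fst).
  apply: (measurableT_comp (measurable_fun_code phi mc)).
  exact: (measurableT_comp (@measurable_coord d X i) measurable_snd).
have F01 m z : 0 <= F m z <= 1.
  have h (i : 'I_m) : 0 <= expR (- (phi (c ((z.2 : nat -> X) i)) * (z.1 : conic_seq R) i)) <= 1.
    exact/expRN01/mulr_ge0.
  apply/andP; split; first by apply: prodr_ge0 => i _; have /andP[] := h i.
  by apply: prodr_ile1 => i _; exact: h.
rewrite (_ : (fun m => _) = fun m => \int[(kappa \x rho)%E]_z F m z); last first.
  apply/funext => m; rewrite /Rintegral fubini_tonelli1/=.
  - congr fine; apply: eq_integral => q _; rewrite /fubini_F/=.
    rewrite -[RHS]fineK.
      congr EFin; rewrite -[RHS]/(Rintegral _ _ _).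
      rewrite (Rintegral_power_prod (g := fun i k => expR (- (phi k * (q : conic_seq R) i))))//.
    have ib : rho.-integrable setT (EFin \o (fun y => F m (q, y))).
      apply: (@bounded_integrable _ _ _ rho _ 1).
        exact: (measurableT_comp (mF m) (@pair1_measurable _ _ _ _ q)).
      by move=> y; have /andP[a b] := F01 m (q, y); rewrite ger0_norm.
    exact: (integrable_fin_num _ ib).
  - exact/measurable_EFinP.
  - by move=> z; rewrite lee_fin; case/andP: (F01 m z).
apply: (@Rintegral_bounded_cvg _ _ _ _ _ _ 1) => //.
  by move=> m z; have /andP[a b] := F01 m z; rewrite ger0_norm.
move=> z; rewrite (_ : (fun m => _) = fun m =>
   expR (- \sum_k phi k * partial_atoms (z.1 : conic_seq R) z.2 m (c @^-1` [set k]))); last first.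
  by apply/funext => m; rewrite partial_atoms_code -sumrN expR_sum.
apply: continuous_cvg; first exact: continuous_expR.
apply: cvgN; apply: cvg_big => [|k _]; first exact: add_continuous.
apply: cvgM; first exact: cvg_cst.
exact: partial_atoms_cvg.
Qed.

End resampled_laplace.

(** * Uniqueness of the Laplace transform *)

Section threshold.
Context (R : realType).
Implicit Types (t v a : R).

(** A polynomial in [exp (- t v)] that tends to the indicator of [t * v > ln
    2]. Writing [a] for [t * v - ln 2], the exponent [n * 2 ^ n] makes [(n * 2
    ^ n) * exp (- t v) ^ n] equal to [n * exp (- n a)], which tends to zero if
    [a > 0] and is at least [n] if [a <= 0]. The factor [n] in the exponent
    puts [a = 0] in the second case. *)
Definition threshold t n v : R := (1 - expR (- (t * v)) ^+ n) ^+ (n * 2 ^ n).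

Lemma threshold01 t n v : 0 <= t -> 0 <= v -> 0 <= threshold t n v <= 1.
Proof.
move=> t0 v0; have /andP[e0 e1] := expRN01 (mulr_ge0 t0 v0).
have x1 : expR (- (t * v)) ^+ n <= 1 by rewrite exprn_ile1.
by rewrite exprn_ge0 ?subr_ge0//= exprn_ile1 ?subr_ge0// gerBl exprn_ge0.
Qed.

Lemma invr_nat_cvg0 (C : R) : C / n%:R @[n --> \oo] --> 0.
Proof.
rewrite -[X in _ --> X](mulr0 C); apply: cvgM; first exact: cvg_cst.
rewrite -(cvg_shiftS (fun n : nat => n%:R^-1 : R)).
exact: cvg_harmonic.
Qed.

Lemma mul_expRN_cvg0 a : 0 < a -> n%:R * expR (- (n%:R * a)) @[n --> \oo] --> 0.
Proof.
move=> a0; apply: (@squeeze_cvgr _ _ _ _ (cst 0) (fun n : nat => (4 / a ^+ 2) / n%:R)).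
- near=> n; rewrite mulr_ge0 ?expR_ge0//=.
  have n0 : 0 < n%:R :> R by rewrite ltr0n; near: n; exact: nbhs_infty_gt.
  rewrite expRN ler_pdivrMr ?expR_gt0//.
  have : (n%:R * a / 2) ^+ 2 <= expR (n%:R * a).
    have -> : n%:R * a = (n%:R * a / 2) * 2%:R by field.
    rewrite expRM_natr// mulfK// lerXn2r ?nnegrE ?expR_ge0//.
      by rewrite divr_ge0// mulr_ge0// ltW.
    by apply: le_trans (expR_ge1Dx _); rewrite lerDr.
  have an0 : a != 0 by rewrite gt_eqF.
  have nn0 : n%:R != 0 :> R by rewrite gt_eqF.
  rewrite [X in _ -> X <= _](_ : _ = 4 / a ^+ 2 / n%:R * (n%:R * a / 2) ^+ 2); last by field; rewrite ?an0 ?nn0.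
  by apply: ler_wpM2l; rewrite !divr_ge0// exprn_ge0// ltW.
- exact: cvg_cst.
- exact: invr_nat_cvg0.
Unshelve. all: by end_near. Qed.

Lemma threshold_cvg t v : 0 <= t -> 0 <= v ->
  threshold t n v @[n --> \oo] --> ((ln 2 < t * v)%R%:R : R).
Proof.
move=> t0 v0; set a := t * v - ln 2.
have NE n : (n * 2 ^ n)%:R * expR (- (t * v)) ^+ n = n%:R * expR (- (n%:R * a)).
  rewrite natrM natrX -[2%:R](@lnK R) ?posrE// -mulrA; congr (_ * _).
  rewrite -!expRM_natr -expRD; congr expR; rewrite /a; ring.
have x01 n : 0 <= expR (- (t * v)) ^+ n <= 1.
  have /andP[e0 e1] := expRN01 (mulr_ge0 t0 v0).
  by rewrite exprn_ge0//= exprn_ile1.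
case: ltP => tv.
  have a0 : 0 < a by rewrite subr_gt0.
  apply/cvgrPdist_lt => e e0; near=> n.
  have /andP[x0 x1] := x01 n.
  have : `|1 - threshold t n v| <= n%:R * expR (- (n%:R * a)).
    rewrite -NE /threshold; set x := expR _ ^+ n; set N := (n * 2 ^ n)%N.
    have : `|\prod_(i < N) 1 - \prod_(i < N) (1 - x)| <= \sum_(i < N) `|1 - (1 - x)|.
      by apply: prod_unit_dist => i; rewrite ?ler01 ?lexx// subr_ge0 x1 gerBl.
    rewrite !prodr_const !card_ord expr1n sumr_const card_ord => /le_trans; apply.
    by rewrite opprB addrC subrK ger0_norm// mulr_natl.
  move/le_lt_trans; apply; near: n.
  by move: (mul_expRN_cvg0 a0) => /cvgr_lt; exact.
apply/cvgrPdist_lt => e e0; near=> n.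
have n0 : 0 < n%:R :> R by rewrite ltr0n; near: n; exact: nbhs_infty_gt.
rewrite sub0r normrN; have /andP[h0 _] := threshold01 n t0 v0; rewrite ger0_norm//.
apply: (@le_lt_trans _ _ (1 / n%:R)); last first.
  by near: n; move: (invr_nat_cvg0 1) => /cvgr_lt; exact.
apply: (@le_trans _ _ (expR (- n%:R))).
  have /andP[x0 x1] := x01 n.
  rewrite /threshold; apply: (@le_trans _ _ (expR (- expR (- (t * v)) ^+ n) ^+ (n * 2 ^ n))).
    rewrite lerXn2r ?nnegrE ?subr_ge0 ?expR_ge0//; exact: expR_ge1Dx.
  rewrite -expRM_natr ler_expR mulNr lerN2 mulrC NE ler_peMr// -expR0 ler_expR oppr_ge0.
  by rewrite mulr_ge0_le0// subr_le0.
rewrite expRN div1r lef_pV2 ?posrE ?expR_gt0//.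
by rewrite (le_trans _ (expR_ge1Dx _))// lerDr.
Unshelve. all: by end_near. Qed.

End threshold.

Section laplace_unique.
Context (R : realType) d (X : measurableType d).
Context (P1 P2 : probability (dplus_space R X) R).
Hypothesis laplaceE : forall (K : finType) (c : X -> K) (phi : K -> R),
  measurable_code c -> (forall k, 0 <= phi k) ->
  \int[P1]_eta expR (- \sum_k phi k * fine ((eta : dplus R X) (c @^-1` [set k]))) =
  \int[P2]_eta expR (- \sum_k phi k * fine ((eta : dplus R X) (c @^-1` [set k]))).

Lemma evaluation_code (eta : dplus R X) (D : nat -> set X) r (j : 'I_r) :
  (forall j, measurable (D j)) ->
  fine (eta (D j)) = \sum_(k : {ffun 'I_r -> bool}) (k j)%:R * fine (eta (code_of D r @^-1` [set k])).
Proof.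
move=> mD.
rewrite -(Rintegral_code eta (g := fun k : {ffun 'I_r -> bool} => (k j)%:R) (@measurable_code_of _ _ _ r mD))//.
rewrite (_ : fine _ = \int[eta]_x \1_(D j) x).
  by apply: eq_Rintegral => x _; rewrite indicE /code_of ffunE; congr (nat_of_bool _)%:R.
by rewrite /Rintegral integral_indic// setIT.
Qed.

(** Any finite family of sets is coarser than the partition that it generates. *)
Lemma laplace_family (D : nat -> set X) r (s : 'I_r -> R) :
  (forall j, measurable (D j)) -> (forall j, 0 <= s j) ->
  \int[P1]_eta expR (- \sum_j s j * fine ((eta : dplus R X) (D j))) =
  \int[P2]_eta expR (- \sum_j s j * fine ((eta : dplus R X) (D j))).
Proof.
move=> mD s0; pose phi (k : {ffun 'I_r -> bool}) := \sum_j s j * (k j)%:R.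
have E eta : \sum_j s j * fine ((eta : dplus R X) (D j)) =
    \sum_k phi k * fine ((eta : dplus R X) (code_of D r @^-1` [set k])).
  under eq_bigr do rewrite (evaluation_code _ _ mD) mulr_sumr.
  rewrite exchange_big/=; apply: eq_bigr => k _; rewrite mulr_suml.
  by apply: eq_bigr => j _; rewrite mulrA.
under eq_Rintegral do rewrite E.
rewrite laplaceE.
- by apply: eq_Rintegral => eta _; rewrite E.
- exact: measurable_code_of.
- by move=> k; apply: sumr_ge0 => j _; rewrite mulr_ge0.
Qed.

(** The binomial formula turns the product of thresholds into a linear
    combination of Laplace transforms of the family. *)
Lemma laplace_threshold (D : nat -> set X) r (t : 'I_r -> R) n :
  (forall j, measurable (D j)) -> (forall j, 0 <= t j) ->
  \int[P1]_eta (\prod_j threshold (t j) n (fine ((eta : dplus R X) (D j)))) =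
  \int[P2]_eta (\prod_j threshold (t j) n (fine ((eta : dplus R X) (D j)))).
Proof.
move=> mD t0; set N := (n * 2 ^ n)%N.
pose a (i : 'I_N.+1) : R := ((-1) ^+ i) *+ 'C(N, i).
have E (eta : dplus_space R X) :
    \prod_j threshold (t j) n (fine ((eta : dplus R X) (D j))) =
    \sum_(f : {ffun 'I_r -> 'I_N.+1}) (\prod_j a (f j)) *
      expR (- \sum_j (t j * (n * f j)%:R) * fine ((eta : dplus R X) (D j))).
  rewrite /threshold; under eq_bigr do rewrite exprBn.
  rewrite bigA_distr_bigA; apply: eq_bigr => f _.
  rewrite -sumrN expR_sum -big_split/=; apply: eq_bigr => j _.
  rewrite expr1n mulr1 -mulrnAl; congr (_ * _).
  by rewrite -exprM -expRM_natr; congr expR; ring.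
have ige (P : probability (dplus_space R X) R) : 
  \int[P]_eta (\prod_j threshold (t j) n (fine ((eta : dplus R X) (D j)))) =
  \sum_(f : {ffun 'I_r -> 'I_N.+1}) (\prod_j a (f j)) *
    \int[P]_eta expR (- \sum_j (t j * (n * f j)%:R) * fine ((eta : dplus R X) (D j))).
  under eq_Rintegral do rewrite E.
  have ie (f : {ffun 'I_r -> 'I_N.+1}) : P.-integrable setT (EFin \o (fun eta : dplus_space R X =>
      expR (- \sum_j (t j * (n * f j)%:R) * fine ((eta : dplus R X) (D j))))).
    apply: (@bounded_integrable _ _ _ P _ 1).
      apply: measurableT_comp => //; apply: measurableT_comp => //.
      apply: measurable_sum => k; apply: measurable_funM => //.
      exact: measurable_fine_evaluation.
    move=> eta; rewrite ger0_norm ?expR_ge0//.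
    have /expRN01/andP[_] // : 0 <= \sum_j (t j * (n * f j)%:R) * fine ((eta : dplus R X) (D j)).
    by apply: sumr_ge0 => j _; rewrite !mulr_ge0// fine_ge0.
  rewrite Rintegral_sum.
    by apply: eq_bigr => f _; rewrite RintegralZl.
  move=> f; rewrite (_ : _ \o _ = fun eta => ((\prod_j a (f j))%:E * 
     (expR (- \sum_j (t j * (n * f j)%:R) * fine ((eta : dplus R X) (D j))))%:E)%E).
    by apply: integrableZl => //; exact: ie.
  by apply/funext => eta /=; rewrite EFinM.
rewrite !ige; apply: eq_bigr => f _; congr (_ * _).
by apply: laplace_family => // j; rewrite mulr_ge0.
Qed.

Definition exceed (D : nat -> set X) (c : nat -> R) r : set (dplus_space R X) :=
  [set eta | forall j, (j < r)%N -> c j < fine ((eta : dplus R X) (D j))].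

Lemma measurable_exceed D c r : (forall j, measurable (D j)) -> measurable (exceed D c r).
Proof.
move=> mD.
rewrite (_ : exceed D c r = \bigcap_(j in `I_r)
    ((fun eta : dplus_space R X => fine ((eta : dplus R X) (D j))) @^-1` `]c j, +oo[)).
  apply: fin_bigcap_measurable => // j _.
  rewrite -[X in measurable X]setTI.
  by apply: (measurable_fine_evaluation (mD j)) => //; exact: measurable_itv.
by apply/seteqP; split=> eta /= h j jr; have := h j jr; rewrite /= in_itv/= andbT.
Qed.

(** The choice [t = ln 2 / c] turns the threshold [ln 2 < t * v] into [c < v]. *)
Lemma exceedE D c r : (forall j, measurable (D j)) -> (forall j, 0 < c j) ->
  P1 (exceed D c r) = P2 (exceed D c r).
Proof.
move=> mD c0; pose t j := ln 2 / c j.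
have ln20 : 0 < ln 2 :> R by rewrite ln_gt0// ltr1n.
have t0 j : 0 <= t j by rewrite divr_ge0// ltW.
have tE j v : (ln 2 < t j * v) = (c j < v).
  by rewrite /t mulrAC ltr_pdivlMr// ltr_pM2l.
have lim (P : probability (dplus_space R X) R) :
    \int[P]_eta (\prod_(j < r) threshold (t j) n (fine ((eta : dplus R X) (D j)))) @[n --> \oo]
    --> fine (P (exceed D c r)).
  have -> : fine (P (exceed D c r)) = \int[P]_eta \1_(exceed D c r) eta.
    by rewrite /Rintegral integral_indic ?setIT//; exact: measurable_exceed.
  have th01 n eta (j : 'I_r) := threshold01 n (t0 j) (fine_ge0 (measure_ge0 (eta : dplus R X) (D j))).
  apply: (@Rintegral_bounded_cvg _ _ _ _ _ _ 1).
  - move=> n; apply: measurable_prod => j _.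
    apply: measurable_funX; apply: measurable_funB => //; apply: measurable_funX.
    apply: measurableT_comp => //; apply: measurableT_comp => //; apply: measurable_funM => //.
    exact: measurable_fine_evaluation.
  - move=> n eta; rewrite ger0_norm; first by apply: prodr_ile1 => j _; exact: th01.
    by apply: prodr_ge0 => j _; have /andP[] := th01 n eta j.
  - move=> eta; rewrite (_ : \1_(exceed D c r) eta =
       \prod_(j < r) (ln 2 < t j * fine ((eta : dplus R X) (D j)))%R%:R).
      apply: cvg_big => [|j _]; first exact: mul_continuous.
      by apply: threshold_cvg => //; exact: fine_ge0.
    rewrite indicE; case: (boolP (eta \in _)) => [/set_mem h|].
      by rewrite big1// => j _; rewrite tE h.
    rewrite notin_setE => h.
    have [j hj] : exists j : 'I_r, ~ c j < fine ((eta : dplus R X) (D j)).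
      apply: contrapT => /forallNP h'; apply: h => j jr.
      by have /contrapT := h' (Ordinal jr).
    by rewrite (bigD1 j)//= tE (negbTE (introN idP hj)) mul0r.
have := lim P2; rewrite (_ : (fun n => _) = fun n => 
    \int[P1]_eta (\prod_(j < r) threshold (t j) n (fine ((eta : dplus R X) (D j))))); last first.
  by apply/funext => n; rewrite laplace_threshold.
move=> /(cvg_unique (@Rhausdorff R) (lim P1)) fE.
rewrite -[LHS]fineK ?fE ?fineK//; rewrite fin_num_measure//; exact: measurable_exceed.
Qed.

(** Only positive levels [c] occur, as these are the ones that thresholds can
    reach; they suffice to generate the sigma-algebra because the masses are
    nonnegative. *)
Definition exceed_sets : set (set (dplus_space R X)) :=
  [set B | exists (D : nat -> set X) (c : nat -> R) r,
    [/\ forall j, measurable (D j), forall j, 0 < c j & B = exceed D c r]].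

Lemma exceed_setsI : setI_closed exceed_sets.
Proof.
move=> _ _ [D [c [r [mD c0 ->]]]] [D' [c' [r' [mD' c0' ->]]]].
exists (fun j => if (j < r)%N then D j else D' (j - r)%N),
  (fun j => if (j < r)%N then c j else c' (j - r)%N), (r + r')%N; split.
- by move=> j; case: ifP.
- by move=> j; case: ifP.
apply/seteqP; split=> eta /=.
  move=> [h h'] j jrr; case: ltnP => jr; first exact: h.
  by apply: h'; rewrite ltn_subLR.
move=> h; split=> j jr; first by have := h j (ltn_addr _ jr); rewrite jr.
by have := h (r + j)%N; rewrite ltn_add2l => /(_ jr); rewrite ltnNge leq_addr/= addKn.
Qed.

Let I : measurableType _ := g_sigma_algebraType exceed_sets.

Let measurable_fine_I A : measurable A ->
  measurable_fun setT (fun eta : I => fine ((eta : dplus R X) A)).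
Proof.
move=> mA.
pose ray c : set I := fun eta => c < fine ((eta : dplus R X) A).
have pos c : 0 < c -> measurable (ray c).
  move=> c0; apply: sub_sigma_algebra; exists (fun=> A), (fun=> c), 1%N; split => //.
  by apply/seteqP; split => eta /= h; [move=> j _|exact: (h 0%N)].
apply: (measurability (@RGenOInfty.G R)); first exact: RGenOInfty.measurableE.
move=> _ [_ [c ->] <-]; rewrite setTI.
rewrite (_ : _ @^-1` _ = ray c); last first.
  by apply/seteqP; split => eta /=; rewrite in_itv/= andbT.
have [c0|] := ltP 0 c; first exact: pos.
rewrite le_eqVlt => /predU1P[->|c0].
  rewrite (_ : ray 0 = \bigcup_n ray n.+1%:R^-1).
    by apply: bigcupT_measurable => n; apply: pos; rewrite invr_gt0.
  apply/seteqP; split => eta /=.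
    move=> h; have [n _ /(_ n (leqnn n)) hn] := near_infty_natSinv_lt (PosNum h).
    by exists n.
  by move=> [n _] /=; apply: lt_trans; rewrite invr_gt0.
rewrite (_ : ray c = setT) //; apply/seteqP; split=> // eta _ /=.
by rewrite /ray (lt_le_trans c0)// fine_ge0.
Qed.

Lemma measurable_exceed_sets : @measurable _ (dplus_space R X) = <<s exceed_sets >>.
Proof.
apply/seteqP; split; last first.
  apply: smallest_sub; first exact: sigma_algebra_measurable.
  by move=> _ [D [c [r [mD _ ->]]]]; exact: measurable_exceed.
apply: smallest_sub; first exact: smallest_sigma_algebra.
move=> _ [A mA [B mB <-]].
have : measurable_fun setT (fun eta : I => (eta : dplus R X) A).
  rewrite (_ : (fun eta => _) = EFin \o (fun eta : I => fine ((eta : dplus R X) A))).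
    by apply/measurable_EFinP; exact: measurable_fine_I.
  by apply/funext => eta /=; rewrite fineK// fin_num_measure.
by move=> /(_ measurableT B mB).
Qed.

Lemma laplace_unique (A : set (dplus_space R X)) : measurable A -> P1 A = P2 A.
Proof.
move=> mA; apply: (measure_unique exceed_sets (fun=> setT)) => //.
- exact: measurable_exceed_sets.
- exact: exceed_setsI.
- move=> _; exists (fun=> setT), (fun=> 1), 0%N; split => //.
  by apply/seteqP; split.
- by rewrite bigcup_const.
- by move=> _ [D [c [r [mD c0 ->]]]]; exact: exceedE.
- by move=> _; rewrite (le_lt_trans (probability_le1 _ _))// ltry.
Qed.

End laplace_unique.

(** * Orderings of the atoms *)

Lemma no_injection_lt (f : nat -> nat) n : injective f -> (forall i, (i <= n)%N -> (f i < n)%N) -> False.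
Proof.
move=> fI fn; pose g (i : 'I_n.+1) : 'I_n := Ordinal (fn i (ltn_ord i)).
have /leq_card : injective g by move=> i j [] /fI /val_inj.
by rewrite !card_ord ltnn.
Qed.

(** If [a j < b j], then [f] would send the [j + 1] first indices below [j],
    since their values exceed [a j]. *)
Lemma noninc_rearrange_le (R : realDomainType) (a b : nat -> R) (f : nat -> nat) :
  (forall i j, (i <= j)%N -> a j <= a i) -> (forall i j, (i <= j)%N -> b j <= b i) ->
  injective f -> (forall i, b i = a (f i)) -> forall i, b i <= a i.
Proof.
move=> na nb fI ba j; rewrite leNgt; apply/negP => abj.
apply: (no_injection_lt (n := j) fI) => i ij; rewrite ltnNge; apply/negP => jfi.
have := na _ _ jfi; rewrite -ba leNgt => /negP; apply.
exact: (lt_le_trans abj (nb _ _ ij)).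
Qed.

Section atoms.
Context (R : realType) d (X : measurableType d).
Implicit Types (eta : dplus R X) (q : conic_seq R) (x : nat -> X).

Lemma ordered_atoms_set1 eta q x i : ordered_atoms eta q x -> 0 < q i ->
  eta [set x i] = (q i)%:E.
Proof.
move=> [-> xI] qi; apply: lim_near_cst => //; exists i.+1 => // n /= ni.
rewrite big_mkord (bigD1 (Ordinal ni))//= big1.
  by rewrite adde0 diracE mem_set// mule1.
move=> j ji; rewrite diracE; have [->|qj] := eqVneq (q j) 0; first by rewrite mul0e.
rewrite memNset ?mule0// => xji; move/eqP: ji; apply; apply: val_inj => /=.
by apply: xI => //; rewrite lt0r qj charge_of_ge0.
Qed.

Lemma ordered_atoms_mem eta q x (A : set X) : ordered_atoms eta q x -> eta A != 0%E ->
  exists2 i, 0 < q i & A (x i).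
Proof.
move=> [etaE _] etaA; apply: contrapT => h; move/eqP: etaA; apply.
rewrite etaE /atomic_sum eseries0// => i _ _; rewrite diracE.
have [->|qi] := eqVneq (q i) 0; first by rewrite mul0e.
rewrite memNset ?mule0// => Axi; apply: h; exists i => //.
by rewrite lt0r qi charge_of_ge0.
Qed.

(** The atoms of the measure, with their masses, can be read off from it, so
    two listings differ by a bijection of the positive indices. Infinitely
    many positive charges in the first listing leave no room for a zero charge
    in the second, and a nonincreasing sequence is determined by its values
    with multiplicities. *)
Lemma ordered_atoms_unique eta q y q' x : (forall i, 0 < q i) ->
  ordered_atoms eta q y -> ordered_atoms eta q' x ->
  q' = q /\ exists f : nat -> nat, [/\ injective f, forall i, q (f i) = q i & forall i, x i = y (f i)].
Proof.
move=> qp oq oq'.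
have transfer (q1 q2 : conic_seq R) x1 x2 : ordered_atoms eta q1 x1 -> ordered_atoms eta q2 x2 ->
    (forall i, 0 < q1 i) -> exists f : nat -> nat,
    [/\ injective f, forall i, x2 (f i) = x1 i & forall i, q2 (f i) = q1 i].
  move=> o1 o2 q1p.
  have /choice[f hf] : forall i, exists j, 0 < q2 j /\ x2 j = x1 i.
    move=> i; have := ordered_atoms_set1 o1 (q1p i) => e1.
    have [|j q2j /= <-] := ordered_atoms_mem (A := [set x1 i]) o2; last by exists j.
    by rewrite e1 eqe gt_eqF.
  exists f; split.
  - by move=> i j fij; apply: o1.2 => //; rewrite -(hf i).2 -(hf j).2 fij.
  - by move=> i; exact: (hf i).2.
  - move=> i; apply: EFin_inj; rewrite -(ordered_atoms_set1 o2 (hf i).1) (hf i).2.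
    exact: (ordered_atoms_set1 o1).
have [g [gI gx gq]] := transfer _ _ _ _ oq oq' qp.
(* A zero charge [q' i] would confine the images of all indices below [i]. *)
have q'p i : 0 < q' i.
  rewrite lt0r charge_of_ge0 andbT; apply/eqP => q'i.
  apply: (no_injection_lt (n := i) gI) => j _; rewrite ltnNge; apply/negP => ij.
  by have := charge_of_noninc q' ij; rewrite gq q'i leNgt qp.
have [f [fI fx fq]] := transfer _ _ _ _ oq' oq q'p.
have qq' i : q' i = q i.
  apply/eqP; rewrite eq_le; apply/andP; split.
    apply: (noninc_rearrange_le (f := f)) => //; exact: charge_of_noninc.
  apply: (noninc_rearrange_le (f := g)) => //; exact: charge_of_noninc.
split; last first.
  by exists f; split => // i; rewrite fq qq'.
case: q' q {transfer oq oq' qp gq q'p fq} qq' => [a a1 a2 a3] [b b1 b2 b3] /= ab.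
have eab : a = b by apply/funext.
by subst b; congr ConicSeq; exact: Prop_irrelevance.
Qed.

End atoms.

Section permuted_coordinates.
Context d (X : measurableType d) (m : nat).
Implicit Types (s : 'S_m) (x : nat -> X).

Definition perm_nat s (k : nat) : nat := if insub k is Some i then val (s i) else k.

Lemma perm_nat_ord s (i : 'I_m) : perm_nat s i = s i.
Proof. by rewrite /perm_nat valK. Qed.

Definition perm_coords s x : nat -> X := fun k => x (perm_nat s k).

Lemma measurable_perm_coords s :
  measurable_fun setT (fun x : seq_space X => perm_coords s x : seq_space X).
Proof. by apply: measurable_to_seq => i; exact: measurable_coord. Qed.

Lemma perm_coords1 x : perm_coords 1%g x = x.
Proof.
apply/funext => k; rewrite /perm_coords /perm_nat.
by case: insubP => // i _ <-; rewrite perm1.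
Qed.

Lemma perm_coords_tperm s (i j : 'I_m) x :
  perm_coords (s * tperm i j)%g x = perm_coords s (swap_coords i j x).
Proof.
apply/funext => k; rewrite /perm_coords /perm_nat /swap_coords.
case: insubP => [l _ _|]; first rewrite permM.
  case: tpermP => [->|->|/eqP + /eqP]; rewrite ?eqxx//.
    by have [->|] := eqVneq (val j) i.
  by rewrite -!(inj_eq val_inj) => /negPf-> /negPf->.
rewrite -leqNgt => mk; rewrite !gtn_eqF//; exact: leq_trans (ltn_ord _) mk.
Qed.

End permuted_coordinates.

(** * Fair ties average over permutations *)

Section fair_order.
Context (R : realType) d (X : measurableType d).
Context d' (W : measurableType d') (U : probability W R)
    (T : {mfun (dplus_space R X * W)%type >-> (conic_space R * seq_space X)%type}).
Hypothesis hT : ordering_map T.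
Context (eta : dplus_space R X) (q : conic_seq R) (y : nat -> X).
Hypotheses (qp : forall i, 0 < q i) (oq : ordered_atoms eta q y).
Hypothesis fair : fair_ties U T eta.

Let x (w : W) : seq_space X := (T (eta, w)).2.

Let measurable_x : measurable_fun setT x.
Proof.
apply: (measurableT_comp measurable_snd).
exact: (measurableT_comp (measurable_funPT T) (@pair1_measurable _ _ _ _ eta)).
Qed.

Lemma ordering_charges w : (T (eta, w)).1 = q.
Proof. by have [] := ordered_atoms_unique qp oq (hT eta w). Qed.

Context (m : nat).

Definition tie_group : {set 'S_m} :=
  finset (fun s : 'S_m => [forall i : 'I_m, q (s i) == q i]).

Lemma tie_groupP (s : 'S_m) : reflect (forall i, q (s i) = q i) (s \in tie_group).
Proof. by rewrite inE; apply: (iffP forallP) => h i; apply/eqP; exact: h. Qed.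

Lemma tie_group_mul (s t : 'S_m) : s \in tie_group -> t \in tie_group -> (s * t)%g \in tie_group.
Proof.
move=> /tie_groupP hs /tie_groupP ht; apply/tie_groupP => i.
by rewrite permM ht hs.
Qed.

Let measurable_pull (B : set (seq_space X)) : measurable B -> measurable [set w | B (x w)].
Proof. by move=> mB; rewrite -[X in measurable X]setTI; apply: measurable_x. Qed.

(** Fairness of ties concerns transpositions. A permutation in the tie group
    is a product of transpositions of the tie group: composing it with the
    transposition of a moved index and its image fixes one more index. *)
Lemma fair_perm (s : 'S_m) (B : set (seq_space X)) : s \in tie_group -> measurable B ->
  U [set w | B (perm_coords s (x w))] = U [set w | B (x w)].
Proof.
have [k] := ubnP #|finset (fun i => s i != i)|.
elim: k s B => // k IH s B; rewrite ltnS => sk sG mB.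
have [->|s1] := eqVneq s 1%g.
  by congr (U _); apply/seteqP; split => w /=; rewrite perm_coords1.
have [i si] : exists i, s i != i.
  apply/existsP; apply: contraNT s1 => /existsPn h; apply/eqP/permP => i.
  by rewrite perm1; apply/eqP; rewrite -[_ == _]negbK; exact: h.
pose t := tperm i (s i); pose s' := (s * t)%g.
have tG : t \in tie_group.
  apply/tie_groupP => j; rewrite /t; case: tpermP => // ->.
    exact/tie_groupP.
  exact/esym/tie_groupP.
have s'G : s' \in tie_group by exact: tie_group_mul.
have -> : s = (s' * t)%g by rewrite /s' -mulgA tperm2 mulg1.
pose B' := (fun z : seq_space X => perm_coords s' z : seq_space X) @^-1` B.
have mB' : measurable B'.
  by have := measurable_perm_coords s' measurableT mB; rewrite setTI.
rewrite (_ : [set w | _] = [set w | B' (swap_coords i (s i) (x w))]); last first.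
  have E0 w := perm_coords_tperm s' i (s i) (x w).
  by apply/seteqP; split => w; rewrite /mkset /B' /preimage E0.
rewrite fair//; last first.
  by move=> w /=; rewrite ordering_charges; split => //; exact/esym/tie_groupP.
apply: IH => //; apply: leq_trans sk; apply: proper_card; apply/properP; split.
  apply/fintype.subsetP => j; rewrite !inE /s' permM; apply: contra => /eqP sj.
  rewrite sj; case: (tpermP i (s i) j) => [ji|jsi|//].
    by rewrite -ji sj.
  by move: sj; rewrite jsi => /perm_inj e; rewrite e eqxx in si.
by exists i; rewrite !inE// /s' permM tpermR eqxx.
Qed.

Hypothesis qm : forall i, (i < m)%N -> q m < q i.

(** The drop after the first [m] charges forces every ordering to list the
    same [m] atoms first. *)
Lemma order_perm w : exists2 s : 'S_m, s \in tie_group & forall i : 'I_m, x w i = y (s i).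
Proof.
have [_ [f [fI fq xf]]] := ordered_atoms_unique qp oq (hT eta w).
have fm (i : 'I_m) : (f i < m)%N.
  rewrite ltnNge; apply/negP => /(charge_of_noninc q).
  by rewrite fq leNgt qm.
have gI : injective (fun i => Ordinal (fm i)) by move=> i j [] /fI /val_inj.
exists (perm gI); first by apply/tie_groupP => i; rewrite permE /= fq.
by move=> i; rewrite permE /=; exact: xf.
Qed.

(** By [fair_perm] the left-hand side is the sum over the tie group of the
    probabilities that a permuted ordering falls in [F]. Inside the
    probability, that sum does not depend on the ordering, because any two
    orderings differ by an element of the group; so it can be evaluated on
    [y]. *)
Lemma fair_average (F : set (seq_space X)) : measurable F -> determined_by m F ->
  (#|tie_group|%:R%:E * U [set w | F (x w)] =
   \sum_(s in tie_group) (\1_F (perm_coords s y))%:E)%E.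
Proof.
move=> mF lF.
have -> : (#|tie_group|%:R%:E * U [set w | F (x w)] =
    \sum_(s in tie_group) U [set w | F (perm_coords s (x w))])%E.
  under [RHS]eq_bigr => s sG do rewrite (fair_perm sG mF).
  by rewrite sumr_const mule_natl.
have mF' s : measurable [set w | F (perm_coords s (x w))].
  rewrite (_ : mkset _ = x @^-1` ((fun z : seq_space X => perm_coords s z : seq_space X) @^-1` F))//.
  by apply: measurable_pull; have := measurable_perm_coords s measurableT mF; rewrite setTI.
transitivity (\int[U]_w (\sum_(s in tie_group) (\1_[set w | F (perm_coords s (x w))] w)%:E))%E.
  under [RHS]eq_integral do rewrite -big_enum/=.
  rewrite ge0_integral_sum//.
  - by rewrite [RHS]big_enum/=; apply: eq_bigr => s _; rewrite integral_indic// setIT.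
  - by move=> s; apply/measurable_EFinP.
transitivity (\int[U]_w (\sum_(s in tie_group) (\1_F (perm_coords s y))%:E))%E; last first.
  by rewrite integral_cst// [X in (_ * X)%E]probability_setT mule1.
apply: eq_integral => w _.
have [t tG xt] := order_perm w.
rewrite [RHS](reindex_inj (mulIg t))/=.
apply: eq_big => s.
  apply/idP/idP => [sG|stG]; first exact: tie_group_mul.
  apply/tie_groupP => i; have /tie_groupP := stG => /(_ i); rewrite permM.
  by have /tie_groupP -> := tG.
move=> sG; congr (EFin _); rewrite !indicE; congr (nat_of_bool _)%:R.
have lF' (z z' : nat -> X) : (forall i, (i < m)%N -> z i = z' i) -> (F z <-> F z').
  by move=> zz'; split; apply: lF => // i /zz'.
have e : F (perm_coords s (x w)) <-> F (perm_coords (s * t)%g y).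
  apply: lF' => i im; rewrite /perm_coords.
  rewrite -[i]/(val (Ordinal im)) !perm_nat_ord permM -xt.
  by [].
by apply/idP/idP => /set_mem/= /e ?; exact/mem_set.
Qed.

End fair_order.

(** * Resampled positions are distinct and exchangeable *)

Section distinct_positions.
Context (R : realType) d (X : measurableType d) (nu : probability X R).
Context (rho : probability (seq_space X) R).
Hypothesis hrho : infinite_power nu rho.

Lemma infinite_power_pair (i j : nat) (A B : set X) : i != j -> measurable A -> measurable B ->
  rho [set y : seq_space X | A ((y : nat -> X) i) /\ B ((y : nat -> X) j)] = (nu A * nu B)%E.
Proof.
move=> ij mA mB; pose n := (maxn i j).+1.
have iN : (i < n)%N by rewrite ltnS leq_maxl.
have jN : (j < n)%N by rewrite ltnS leq_maxr.
pose C k := if k == i then A else if k == j then B else setT.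
have mC k : measurable (C k) by rewrite /C; case: ifP => // _; case: ifP.
rewrite (_ : mkset _ = [set y : nat -> X | forall k, (k < n)%N -> C k (y k)]); last first.
  apply/seteqP; split => y /=.
    move=> [Ai Bj] k _; rewrite /C; case: eqP => [->//|_].
    by case: eqP => [->|].
  move=> h; split; first by have := h i iN; rewrite /C eqxx.
  by have := h j jN; rewrite /C eq_sym (negPf ij) eqxx.
transitivity (\prod_(k < n) nu (C k))%E; first exact: (hrho n mC).
rewrite (bigD1 (Ordinal iN))//= (bigD1 (Ordinal jN))/=; last by rewrite eq_sym.
rewrite big1 => [|k /andP[ki kj]].
  by rewrite mule1 /C eqxx eq_sym (negPf ij) eqxx.
have -> : C k = setT.
  rewrite /C; case: eqP => [e|_].
    by move/eqP: ki; case; apply: val_inj.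
  by case: eqP => [e|//]; move/eqP: kj; case; apply: val_inj.
exact: probability_setT.
Qed.

Context (E : nat -> set X).
Hypotheses (sepE : separating E) (hnu : nonatomic nu).

(** Two coordinates fall in the same cell with probability the sum of the
    squares of the cell masses. *)
Lemma infinite_power_neq (i j : nat) : i != j ->
  {ae rho, forall y : seq_space X, (y : nat -> X) i <> (y : nat -> X) j}.
Proof.
move=> ij; pose D n := [set y : seq_space X | code_of E n ((y : nat -> X) i) = code_of E n ((y : nat -> X) j)].
have mE := @measurable_code_of _ _ E.
pose c n (y : seq_space X) := (code_of E n ((y : nat -> X) i), code_of E n ((y : nat -> X) j)).
have mc n : measurable_code (c n).
  apply: measurable_code_pair => k.
    have := measurable_coord i measurableT (mE n sepE.1 k); rewrite setTI; exact.
  have := measurable_coord j measurableT (mE n sepE.1 k); rewrite setTI; exact.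
have mD n : measurable (D n).
  rewrite (_ : D n = c n @^-1` [set p | p.1 = p.2])//.
  exact: (measurable_code_preimage (c := c n) _ (mc n)).
have rD n : fine (rho (D n)) = \sum_k cell_mass nu E n k ^+ 2.
  have -> : fine (rho (D n)) = \int[rho]_y (fun p : {ffun 'I_n -> bool} * {ffun 'I_n -> bool} => (p.1 == p.2)%:R) (c n y).
    transitivity (\int[rho]_y \1_(D n) y).
      by rewrite /Rintegral integral_indic// setIT.
    apply: eq_Rintegral => y _; rewrite indicE; congr (nat_of_bool _)%:R.
    by apply/idP/idP => [/set_mem h|/eqP h]; [exact/eqP|exact/mem_set].
  rewrite (Rintegral_code rho (g := fun p => (p.1 == p.2)%:R) (mc n))//.
  transitivity (\sum_k \sum_l (k == l)%:R * fine (rho (c n @^-1` [set (k, l)]))).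
    by rewrite pair_bigA/=; apply: eq_bigr => -[k l].
  apply: eq_bigr => k _; rewrite (bigD1 k)//= eqxx mul1r big1 ?addr0; last first.
    by move=> l lk; rewrite eq_sym (negPf lk) mul0r.
  rewrite (_ : c n @^-1` [set (k, k)] = [set y : seq_space X |
     (code_of E n @^-1` [set k]) ((y : nat -> X) i) /\ (code_of E n @^-1` [set k]) ((y : nat -> X) j)]).
    rewrite infinite_power_pair//; try exact: (mE n sepE.1).
    by rewrite fineM// fin_num_measure//; exact: (mE n sepE.1).
  by apply/seteqP; split => y /= [ci cj]; [split|rewrite /c ci cj].
have D0 : rho (\bigcap_n D n) = 0%E.
  have mDD : measurable (\bigcap_n D n) by exact: bigcapT_measurable.
  apply/eqP; rewrite eq_le measure_ge0 andbT.
  rewrite -[leLHS]fineK ?fin_num_measure// lee_fin.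
  apply: (cvgr_to_ge (cell_mass_sq_cvg0 sepE hnu)); near=> n.
  rewrite -rD fine_le ?fin_num_measure//.
  by apply: le_measure => [|| y /(_ n I)//]; exact: mem_set.
exists (\bigcap_n D n); split => //; first exact: bigcapT_measurable.
move=> y /= /contrapT yij n _; by rewrite /D /= yij.
Unshelve. all: by end_near. Qed.

Lemma infinite_power_injective :
  {ae rho, forall y : seq_space X, injective (y : nat -> X)}.
Proof.
have h : {ae rho, forall y : seq_space X, forall i j : nat, i != j -> (y : nat -> X) i <> (y : nat -> X) j}.
  apply/ae_foralln => i; apply/ae_foralln => j.
  have [->|ij] := eqVneq i j; first by apply: aeW.
  by apply: filterS (infinite_power_neq ij) => y yij _.
apply: filterS h => y yI i j yij; apply/eqP; apply: contraT => /yI.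
by move/(_ yij).
Qed.

End distinct_positions.

(** The charges are positive and tend to zero, so beyond any index there is a
    strict drop, and the first [m] charges are then a union of groups of ties. *)
Lemma charge_drop (R : realType) (q : conic_seq R) n : (forall i, 0 < q i) ->
  exists m, (n <= m)%N /\ forall i, (i < m)%N -> q m < q i.
Proof.
move=> qp.
have exm : exists m, q m < q n.
  have q0 : (q : nat -> R) @ \oo --> 0 by apply: cvg_series_cvg_0; exact: charge_of_summable.
  have [m _ /(_ m (leqnn m))] : \forall m \near \oo, q m < q n.
    by move: q0 => /cvgr_lt; apply.
  by exists m.
have [m qm mmin] := ex_minnP exm.
have nm : (n <= m)%N.
  by rewrite leqNgt; apply/negP => /ltnW /(charge_of_noninc q); rewrite leNgt qm.
exists m; split => // i im; rewrite (lt_le_trans qm)// leNgt; apply/negP => /mmin.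
by rewrite leqNgt im.
Qed.

Section permuted_box.
Context (R : realType) d (X : measurableType d) (nu : probability X R).
Context (rho : probability (seq_space X) R).
Hypothesis hrho : infinite_power nu rho.

(** Exchangeability of an iid sequence. *)
Lemma infinite_power_perm m (s : 'S_m) (B : nat -> set X) : (forall i, measurable (B i)) ->
  rho [set y : seq_space X | box m B (perm_coords s y)] = (\prod_(i < m) nu (B i))%E.
Proof.
move=> mB; pose C j := B (perm_nat s^-1%g j).
have mC j : measurable (C j) by exact: mB.
transitivity (rho (box m C)).
  congr (rho _); apply/seteqP; split => y /= h i im.
    rewrite /C -[i]/(val (Ordinal im)) perm_nat_ord.
    have := h (s^-1%g (Ordinal im)) (ltn_ord _).
    by rewrite /perm_coords perm_nat_ord permKV.
  rewrite /perm_coords -[i]/(val (Ordinal im)) perm_nat_ord.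
  have := h (s (Ordinal im)) (ltn_ord _).
  by rewrite /C perm_nat_ord permK.
transitivity (\prod_(j < m) nu (C j))%E; first exact: (hrho m mC).
rewrite (reindex_inj (@perm_inj _ s))/=; apply: eq_bigr => i _.
by rewrite /C perm_nat_ord permK.
Qed.

Context d' (W : measurableType d') (U : probability W R)
    (T : {mfun (dplus_space R X * W)%type >-> (conic_space R * seq_space X)%type}).
Hypothesis hT : ordering_map T.

Lemma measurable_ordering_prob (A : set (conic_space R * seq_space X)%type) : measurable A ->
  measurable_fun setT (fun eta => U [set w | A (T (eta, w))]).
Proof.
move=> mA; have mTA : measurable (T @^-1` A).
  by rewrite -[X in measurable X]setTI; exact: measurable_funPT.
rewrite (_ : (fun eta => _) = U \o xsection (T @^-1` A)).
  exact: measurable_fun_xsection.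
apply/funext => eta /=; congr (U _); apply/seteqP; split => w /=.
  by rewrite /xsection/= inE.
by rewrite /xsection/= inE.
Qed.

Context (q : conic_space R).
Hypotheses (qp : forall i, 0 < (q : conic_seq R) i)
  (dist : {ae rho, forall y : seq_space X, injective (y : nat -> X)})
  (fair : {ae rho, forall y, fair_ties U T (assemble (q, y))}).

Lemma ordered_atoms_assemble (y : nat -> X) : injective y ->
  ordered_atoms (assemble (q, y : seq_space X)) (q : conic_seq R) y.
Proof. by move=> yI; split => // i j _ _ /yI. Qed.

(** For charges [q] and iid positions [y], an ordering lists the positions [y]
    up to a random permutation of the ties. Averaging over the ties and then
    over the exchangeable positions gives the probability of the box under
    [nu^oo], whatever [q] is. *)
Lemma resampled_positions (C : set (conic_space R)) n (B : nat -> set X) :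
  measurable C -> (forall i, measurable (B i)) ->
  (\int[rho]_y U [set w | (C `*` box n B) (T (assemble (q, y), w))] =
   (\1_C q)%:E * \prod_(i < n) nu (B i))%E.
Proof.
move=> mC mB; have [m [nm qm]] := charge_drop n qp.
(* Pad the box so that its dimension is the length [m] of a union of groups of
   ties. *)
pose B' i := if (i < n)%N then B i else setT.
have mB' i : measurable (B' i) by rewrite /B'; case: ifP.
have boxE : box n B = box m B' :> set (seq_space X).
  apply/seteqP; split => y h i im; rewrite /B'.
    by case: ifP => // /h.
  by have := h i (leq_trans im nm); rewrite /B' im.
have prodE : (\prod_(i < n) nu (B i) = \prod_(i < m) nu (B' i))%E.
  rewrite (big_ord_widen m (fun i => nu (B i)) nm) big_mkcond/=; apply: eq_bigr => i _.
  by rewrite /B'; case: ifP => // _; rewrite probability_setT.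
rewrite boxE prodE {boxE prodE}.
set G := @tie_group R q m; set F := box m B'.
have mF : measurable F by exact: measurable_box.
have mCF : measurable (C `*` F) by exact: measurableX.
have cG : #|G|%:R != 0 :> R.
  rewrite pnatr_eq0 -lt0n; apply/card_gt0P; exists 1%g.
  by apply/tie_groupP => i; rewrite perm1.
have Fs (s : 'S_m) : measurable [set y : seq_space X | F (perm_coords s y)].
  by have := measurable_perm_coords s measurableT mF; rewrite setTI.
have mA : measurable_fun setT (fun y => U [set w | (C `*` F) (T (assemble (q, y), w))]).
  exact: (measurableT_comp (measurableT_comp (measurable_ordering_prob mCF)
    (measurable_funPT (@assemble R d X))) (@pair1_measurable _ _ _ _ q)).
have mS1 s : measurable_fun setT (fun y : seq_space X => (\1_F (perm_coords s y))%:E : \bar R).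
  apply/measurable_EFinP.
  exact: (measurableT_comp (measurable_indic mF) (measurable_perm_coords s)).
have mS : measurable_fun setT (fun y : seq_space X => \sum_(s in G) (\1_F (perm_coords s y))%:E : \bar R)%E.
  rewrite [X in measurable_fun _ X](_ : _ = fun y : seq_space X =>
      \sum_(s <- enum G) (\1_F (perm_coords s y))%:E)%E.
    exact: emeasurable_sum.
  by apply/funext => y; rewrite big_enum.
transitivity (\int[rho]_y ((\1_C q * #|G|%:R^-1)%:E * \sum_(s in G) (\1_F (perm_coords s y))%:E))%E.
  apply: ge0_ae_eq_integral => //.
  - exact: measurable_funeM.
  - move=> y _; rewrite mule_ge0// ?lee_fin ?mulr_ge0 ?invr_ge0//.
    by apply: sume_ge0 => s _; rewrite lee_fin.
  have := @filterI _ (almost_everywhere rho) (ae_filter_ringOfSetsType rho) _ _ dist fair.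
  apply: filterS => y [yI yfair] _.
  have oq := ordered_atoms_assemble yI.
  have := fair_average hT qp oq yfair qm mF (@determined_by_box _ _ m B') => <-.
  rewrite muleA -EFinM mulfVK//.
  rewrite indicE; case: (boolP (q \in C)) => qC.
    rewrite mul1e; congr (U _); apply/seteqP; split => w /=; first by case.
    by move=> Fw; split => //=; rewrite (ordering_charges hT qp oq); exact: set_mem.
  rewrite mul0e (_ : mkset _ = set0) ?measure0// -subset0 => w /= [+ _].
  by rewrite (ordering_charges hT qp oq); move: qC; rewrite notin_setE.
rewrite ge0_integralZl//; last first.
  by move=> y _; apply: sume_ge0 => s _; rewrite lee_fin.
under eq_integral do rewrite -big_enum/=.
rewrite ge0_integral_sum//.
rewrite (eq_bigr (fun=> \prod_(i < m) nu (B' i)))%E; last first.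
  move=> s _; rewrite -(infinite_power_perm s mB').
  transitivity (\int[rho]_y (\1_[set y : seq_space X | F (perm_coords s y)] y)%:E)%E => //.
  by rewrite integral_indic ?setIT.
have sumG (a : \bar R) : (\sum_(s in G) a = #|G|%:R%:E * a)%E.
  by rewrite sumr_const mule_natl.
by rewrite big_enum/= sumG muleA -EFinM mulfVK.
Qed.

End permuted_box.

(** * All charges are positive *)

Section levy_exponent.
Context (R : realType) (Lambda : {measure set (measurableTypeR R) -> \bar R}).
Hypotheses (hinf : Lambda `]0, +oo[%classic = +oo%E)
    (htail : (Lambda `]1%R, +oo[%classic < +oo)%E)
    (hsmall : (\int[Lambda]_(s in `]0%R, 1%R]%classic) s%:E < +oo)%E).

Let f (n : nat) (s : R) : R := 1 - expR (- (n%:R * s)).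

Let measurable_f n D : measurable_fun D (EFin \o f n : measurableTypeR R -> \bar R).
Proof.
apply/measurable_EFinP; apply: measurable_funB => //.
by apply: measurableT_comp => //; apply: measurableT_comp => //; apply: measurable_funM.
Qed.

Let f_ge0 n s : 0 < s -> (0 <= (f n s)%:E)%E.
Proof.
move=> s0; rewrite lee_fin subr_ge0 -expR0 ler_expR oppr_le0 mulr_ge0// ltW//.
Qed.

Let int_f_fin n : (\int[Lambda]_(s in `]0%R, +oo[%classic) (f n s)%:E)%E \is a fin_num.
Proof.
rewrite ge0_fin_numE; last first.
  by apply: integral_ge0 => s /=; rewrite in_itv/= andbT; exact: f_ge0.
rewrite (@itv_bndbnd_setU _ _ _ (BRight 1))//; last by rewrite bnd_simp.
rewrite ge0_integral_setU//=.
- apply: lte_add_pinfty.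
    apply: (@le_lt_trans _ _ (\int[Lambda]_(s in `]0%R, 1%R]%classic) (n%:R%:E * s%:E))%E).
      apply: ge0_le_integral => //=.
      + by move=> s; rewrite in_itv/= => /andP[s0 _]; exact: f_ge0.
      + exact: measurable_f.
      + by apply: measurable_funeM; exact/measurable_EFinP.
      + move=> s; rewrite in_itv/= => /andP[s0 _]; rewrite -EFinM lee_fin.
        have := expR_ge1Dx (- (n%:R * s)); rewrite /f; lra.
    rewrite ge0_integralZl//=; first by rewrite lte_mul_pinfty.
    by move=> s; rewrite in_itv/= => /andP[s0 _]; rewrite lee_fin ltW.
  apply: (@le_lt_trans _ _ (\int[Lambda]_(s in `]1%R, +oo[%classic) (cst 1%E s))%E).
    apply: ge0_le_integral => //=.
    + by move=> s; rewrite in_itv/= andbT => s0; apply: f_ge0; exact: lt_trans s0.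
    + exact: measurable_f.
    + by move=> s _; rewrite lee_fin /f gerBl expR_ge0.
  by rewrite integral_cst// mul1e.
- exact: measurable_f.
- move=> s [|]; rewrite /= in_itv/=.
    by move=> /andP[s0 _]; exact: f_ge0.
  by rewrite andbT => s0; apply: f_ge0; exact: lt_trans s0.
- rewrite disj_set2E; apply/eqP/seteqP; split => // s [] /=; rewrite !in_itv/= andbT.
  by move=> /andP[_ s1]; rewrite ltNge s1.
Qed.

Lemma laplace_exponent_natE n : (laplace_exponent Lambda n%:R)%:E = (\int[Lambda]_(s in `]0%R, +oo[%classic) (f n s)%:E)%E.
Proof. by rewrite -[RHS](fineK (int_f_fin n)) /laplace_exponent /psi expRK opprK. Qed.

(** Monotone convergence, as [1 - exp (- n s)] increases to [1] for [s > 0]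
    and [Lambda] has infinite mass. The other hypotheses make the exponents
    finite, so that their real values are those of the integrals. *)
Lemma laplace_exponent_unbounded M : exists n : nat, M <= laplace_exponent Lambda n%:R.
Proof.
have lim s : 0 < s -> limn (fun n => (f n s)%:E) = 1%E.
  move=> s0; apply/cvg_lim => //; apply: cvg_EFin; first exact: nearW.
  rewrite -[X in _ --> X]subr0; apply: cvgB; first exact: cvg_cst.
  apply: (@squeeze_cvgr _ _ _ _ (cst 0) (fun n : nat => s^-1 / n%:R)).
  - near=> n; rewrite expR_ge0/=.
    have n0 : 0 < n%:R :> R by rewrite ltr0n; near: n; exact: nbhs_infty_gt.
    rewrite expRN -invfM lef_pV2 ?posrE ?expR_gt0 ?mulr_gt0//.
    by rewrite (le_trans _ (expR_ge1Dx _))// mulrC lerDr.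
  - exact: cvg_cst.
  - exact: invr_nat_cvg0.
have : (\int[Lambda]_(s in `]0%R, +oo[%classic) (f n s)%:E)%E @[n --> \oo] --> +oo%E.
  rewrite (_ : +oo%E = (\int[Lambda]_(s in `]0%R, +oo[%classic) limn (fun n => (f n s)%:E))%E); last first.
    rewrite (eq_integral (cst 1%E)) ?integral_cst ?mul1e ?hinf// => s.
    by rewrite inE/= in_itv/= andbT; exact: lim.
  apply: (@cvg_monotone_convergence _ _ _ Lambda _ _ (fun n s => (f n s)%:E)) => //.
  - by move=> n; exact: measurable_f.
  - by move=> n s /=; rewrite in_itv/= andbT; exact: f_ge0.
  - move=> s /=; rewrite in_itv/= andbT => s0 n m nm; rewrite lee_fin /f lerB//.
    by rewrite ler_expR lerN2 ler_wpM2r ?ler_nat// ltW.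
move=> /cvgeyPge/(_ M)[n _ /(_ n (leqnn n))]; rewrite -laplace_exponent_natE lee_fin => h.
by exists n.
Unshelve. all: by end_near. Qed.

End levy_exponent.

(** Take the successive differences of a strictly decreasing sequence of sets
    of positive mass. *)
Lemma nonatomic_disjoint (R : realType) d (X : measurableType d) (nu : probability X R) :
  nonatomic nu -> exists D : nat -> set X,
  [/\ forall k, measurable (D k), trivIset setT D & forall k, (0 < nu (D k))%E].
Proof.
move=> hnu; pose good (A : set X) := measurable A /\ (0 < nu A)%E.
have /choice[f hf] : forall A, exists B, good A -> [/\ good B, B `<=` A & (nu B < nu A)%E].
  move=> A; have [[mA A0]|nA] := pselect (good A); last by exists A.
  by have [B [mB BA /andP[B0 BnuA]]] := hnu _ mA A0; exists B.
pose A n := iter n f setT.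
have gA n : good (A n).
  elim: n => [|n IH]; last by have [] := hf _ IH.
  by split; [exact: measurableT|rewrite /A/= (@probability_setT _ _ _ nu) lte01].
have AS n : A n.+1 `<=` A n by have [] := hf _ (gA n).
have Ale n m : (n <= m)%N -> A m `<=` A n.
  elim: m => [|m IH]; first by rewrite leqn0 => /eqP ->.
  by rewrite leq_eqVlt => /predU1P[->//|]; rewrite ltnS => /IH; apply: subset_trans.
exists (fun k => A k `\` A k.+1); split.
- by move=> k; apply: measurableD; exact: (gA _).1.
- apply: ltn_trivIset => n m nm; rewrite -subset0 => s [[As nAs] [As' _]].
  by apply: nAs; apply: Ale As'.
- move=> k; have mk := (gA k).1; have mk1 := (gA k.+1).1.
  rewrite measureD//.
    rewrite setIidr// sube_gt0//; first by have [] := hf _ (gA k).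
  by rewrite (le_lt_trans (probability_le1 _ mk))// ltry.
Qed.

Section positive_charges.
Context (R : realType) d (X : measurableType d) (nu : probability X R).
Context (Lambda : {measure set (measurableTypeR R) -> \bar R}).
Hypotheses (hinf : Lambda `]0, +oo[%classic = +oo%E)
    (htail : (Lambda `]1%R, +oo[%classic < +oo)%E)
    (hsmall : (\int[Lambda]_(s in `]0%R, 1%R]%classic) s%:E < +oo)%E).
Context (P : probability (dplus_space R X) R).
Hypothesis hP : levy_law nu Lambda P.

(** The probability of mass zero is at most [exp (- nu A * laplace_exponent
    n)], the Laplace transform of the mass at [n], for every [n]. *)
Lemma uncharged_negligible (A : set X) : measurable A -> (0 < nu A)%E ->
  {ae P, forall eta, (eta : dplus R X) A <> 0%E}.
Proof.
move=> mA A0; pose Z := [set eta : dplus_space R X | (eta : dplus R X) A = 0%E].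
have mZ : measurable Z.
  have := @measurable_evaluation R d X A mA measurableT _ (emeasurable_set1 0%E); rewrite setTI.
  exact.
exists Z; split => //; last by move=> eta /= /contrapT.
pose a := fine (nu A).
have a0 : 0 < a by rewrite fine_gt0// A0 (le_lt_trans (probability_le1 _ mA))// ltry.
have bound n : fine (P Z) <= expR (- (a * laplace_exponent Lambda n%:R)).
  pose c x := `[< A x >]; pose phi (b : bool) : R := if b then n%:R else 0.
  have mc : measurable_code c.
    move=> [].
      rewrite (_ : _ @^-1` _ = A)//; apply/seteqP; split => x /=; first by move/asboolP.
      by move=> Ax; exact: asboolT.
    rewrite (_ : _ @^-1` _ = ~` A); first exact: measurableC.
    apply/seteqP; split => x /=; last by move=> Ax; exact: asboolF.
    by move=> h Ax; move: h; rewrite /c asboolT.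
  have cA : c @^-1` [set true] = A.
    by apply/seteqP; split => x /=; [move/asboolP|move=> Ax; exact: asboolT].
  have phi0 b : 0 <= phi b by case: b.
  have L := levy_code hP mc phi0.
  apply: (@le_trans _ _ (expR (- \sum_k fine (nu (c @^-1` [set k])) * laplace_exponent Lambda (phi k)))); last first.
    rewrite ler_expR lerN2 big_bool/= cA lerDl mulr_ge0 ?fine_ge0//.
    exact: laplace_exponent_ge0.
  rewrite -L (_ : fine (P Z) = \int[P]_eta \1_Z eta); last first.
    by rewrite /Rintegral integral_indic ?setIT.
  apply: le_Rintegral => //.
  - apply: (@bounded_integrable _ _ _ P _ 1); first exact: measurable_indic.
    by move=> eta; rewrite indicE ger0_norm//; case: (_ \in _).
  - apply: (@bounded_integrable _ _ _ P _ 1).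
      apply: measurableT_comp => //; apply: measurableT_comp => //.
      apply: measurable_sum => k; apply: measurable_funM => //.
      exact: (measurable_fine_evaluation (mc k)).
    move=> eta; rewrite ger0_norm ?expR_ge0//.
    have /expRN01/andP[_] // : 0 <= \sum_k phi k * fine ((eta : dplus R X) (c @^-1` [set k])).
    by apply: sumr_ge0 => k _; rewrite mulr_ge0// fine_ge0.
  - move=> eta _; rewrite indicE; case: (boolP (eta \in Z)) => [/set_mem Zeta|_]; last exact: expR_ge0.
    by rewrite big_bool/= cA Zeta/= mulr0 mul0r addr0 oppr0 expR0.
apply/eqP; rewrite -[P Z]fineK ?fin_num_measure// eqe eq_le fine_ge0 ?andbT//.
rewrite leNgt; apply/negP => p0.
have [n hn] := laplace_exponent_unbounded hinf htail hsmall ((a * fine (P Z))^-1).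
have := bound n; rewrite leNgt => /negP; apply.
apply: (@le_lt_trans _ _ (expR (- (fine (P Z))^-1))).
  rewrite ler_expR lerN2 -(ler_pdivrMl _ _ a0) (le_trans _ hn)//.
  by rewrite invfM.
rewrite expRN invf_plt ?posrE ?expR_gt0//.
by rewrite (lt_le_trans _ (expR_ge1Dx _))// ltrDr.
Qed.

Hypothesis hnu : nonatomic nu.
Context d' (W : measurableType d') (U : probability W R)
    (T : {mfun (dplus_space R X * W)%type >-> (conic_space R * seq_space X)%type}).
Hypothesis hT : ordering_map T.

Let Pr : probability (dplus_space R X * W)%type R := (P \x U)%E.

(** Infinitely many disjoint sets of positive mass require infinitely many
    atoms, whereas a zero charge at index [i] leaves at most [i] atoms. *)
Lemma ordered_atoms_positive (eta : dplus R X) (q : conic_seq R) (x : nat -> X) (D : nat -> set X) :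
  trivIset setT D -> (forall k, eta (D k) <> 0%E) -> ordered_atoms eta q x ->
  forall i, 0 < q i.
Proof.
move=> tD D0 oq i; rewrite lt0r charge_of_ge0 andbT; apply/eqP => qi.
have /choice[f hf] : forall k, exists j, 0 < q j /\ D k (x j).
  by move=> k; have [|j] := ordered_atoms_mem (A := D k) oq; [exact/eqP|exists j].
apply: (@no_injection_lt f i).
  move=> k l fkl; apply: (tD k l) => //; exists (x (f k)); split; first exact: (hf k).2.
  by rewrite fkl; exact: (hf l).2.
move=> k _; rewrite ltnNge; apply/negP => /(charge_of_noninc q).
by rewrite qi leNgt (hf k).1.
Qed.

Lemma charges_positive :
  {ae distribution Pr (charges T), forall q : conic_space R, forall i, 0 < (q : conic_seq R) i}.
Proof.
have [D [mD tD D0]] := nonatomic_disjoint hnu.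
have [N [mN PN0 subN]] : {ae P, forall eta : dplus_space R X, forall k, (eta : dplus R X) (D k) <> 0%E}.
  by apply/ae_foralln => k; exact: uncharged_negligible.
apply/ae_foralln => i.
pose S := [set q : conic_space R | (q : conic_seq R) i = 0].
have mS : measurable S.
  by have := measurable_charge i measurableT (measurable_set1 (0 : R)); rewrite setTI.
exists S; split => //; last first.
  move=> q /= /negP; rewrite -leNgt => qi; apply/eqP; rewrite eq_le qi.
  exact: charge_of_ge0.
have mTS : measurable (charges T @^-1` S).
  by rewrite -[X in measurable X]setTI; exact: measurable_charges.
rewrite /distribution /pushforward.
apply: (@subset_measure0 _ _ _ Pr _ (N `*` setT)) => //.
- exact: measurableX.
- move=> [eta w] /= S0; split => //=; apply: subN => /= h.
  have := ordered_atoms_positive tD h (hT eta w) i.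
  by move: S0; rewrite /S /charges /= => ->; rewrite ltxx.
- rewrite -[LHS]/((P \x U)%E (N `*` setT)) product_measure1E//.
  by rewrite [X in (X * _)%E](_ : _ = 0%E) ?mul0e.
Qed.

End positive_charges.

(** * Law of the ordered atoms *)

Section boxes.
Context d (X : measurableType d).

Definition boxes : set (set (seq_space X)) :=
  [set F | exists n (B : nat -> set X), (forall i, measurable (B i)) /\ F = box n B].

Lemma boxes_setI : setI_closed boxes.
Proof.
move=> _ _ [n [B [mB ->]]] [m [C [mC ->]]].
pose pad k (D : nat -> set X) i := if (i < k)%N then D i else setT.
have mpad k D : (forall i, measurable (D i)) -> forall i, measurable (pad k D i).
  by move=> mD i; rewrite /pad; case: ifP.
exists (maxn n m), (fun i => pad n B i `&` pad m C i); split.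
  by move=> i; apply: measurableI; exact: mpad.
apply/seteqP; split => x /=.
  by move=> [hB hC] i _; rewrite /pad; split; case: ifP => // ?; [exact: hB|exact: hC].
move=> h; split => i im.
  by have [+ _] := h i (leq_trans im (leq_maxl _ _)); rewrite /pad im.
by have [_ +] := h i (leq_trans im (leq_maxr _ _)); rewrite /pad im.
Qed.

Lemma measurable_boxes : @measurable _ (seq_space X) = <<s boxes >>.
Proof.
apply/seteqP; split; last first.
  apply: smallest_sub; first exact: sigma_algebra_measurable.
  by move=> _ [n [B [mB ->]]]; exact: measurable_box.
apply: smallest_sub; first exact: smallest_sigma_algebra.
move=> _ [i _ [B mB <-]]; apply: sub_sigma_algebra.
exists i.+1, (fun j => if j == i then B else setT); split.
  by move=> j; case: ifP.
apply/seteqP; split => x /=.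
  by move=> [_ Bx] j _; case: eqP => // ->.
by move=> h; split => //; have := h i (ltnSn i); rewrite eqxx.
Qed.

End boxes.

Section conic_part.
Context (R : realType) (d : measure_display) (X : measurableType d).
Context (nu : probability X R).
Hypotheses (hX : standard_borel R X) (hnu : nonatomic nu).
Context (Lambda : {measure set (measurableTypeR R) -> \bar R}).
Hypotheses (hinf : Lambda `]0, +oo[%classic = +oo%E)
    (htail : (Lambda `]1%R, +oo[%classic < +oo)%E)
    (hsmall : (\int[Lambda]_(s in `]0%R, 1%R]%classic) s%:E < +oo)%E).
Context (P : probability (dplus_space R X) R).
Hypothesis hP : levy_law nu Lambda P.
Context (d' : measure_display) (W : measurableType d') (U : probability W R)
    (T : {mfun (dplus_space R X * W)%type >-> (conic_space R * seq_space X)%type}).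
Hypotheses (hT : ordering_map T) (hties : {ae P, forall eta, fair_ties U T eta}).

Let Pr : probability (dplus_space R X * W)%type R := (P \x U)%E.
Let kappa : probability (conic_space R) R := distribution Pr (charges T).
Let rho : probability (seq_space X) R := power_measure nu.
Let P' : probability (dplus_space R X) R :=
  distribution (kappa \x rho : probability (conic_space R * seq_space X)%type R)%E (@assemble R d X).

(** Resampling the positions independently of the charges does not change the
    law of the process: both laws have the same Laplace transform, by
    [expected_charge_product_cvg] and [resampled_laplace]. *)
Lemma resampled_law (A : set (dplus_space R X)) : measurable A -> P A = P' A.
Proof.
apply: laplace_unique => K c phi mc phi0.
rewrite (levy_code hP mc phi0).
have p1 : \sum_k fine (nu (c @^-1` [set k])) = 1.
  have := Rintegral_code nu (g := cst 1) mc (fun=> ler01).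
  rewrite /= Rintegral_cst//= (@probability_setT _ _ _ nu) mulr1 => ->.
  by apply: eq_bigr => k _; rewrite mul1r.
apply: (cvg_unique (@Rhausdorff R)
  (expected_charge_product_cvg hP hX hnu U hT (fun k => fine_ge0 (measure_ge0 nu (c @^-1` [set k]))) p1 phi0)).
exact: (resampled_laplace (kappa := kappa) (@infinite_powerP R d X nu) mc phi0).
Qed.

(** Fairness of ties holds almost surely for the process, hence for the
    resampled process by [resampled_law], and then for almost all charges and
    almost all positions by Fubini. *)
Lemma resampled_fair : {ae kappa, forall q, {ae rho, forall y, fair_ties U T (assemble (q, y))}}.
Proof.
have [N [mN PN subN]] := hties.
have mM : measurable (@assemble R d X @^-1` N).
  by have := @measurable_assemble R d X measurableT _ mN; rewrite setTI.
have := resampled_law mN; rewrite PN => /esym M0.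
have mf : measurable_fun setT (rho \o xsection (@assemble R d X @^-1` N)).
  exact: measurable_fun_xsection.
have /(ae_eq_integral_abs kappa measurableT mf) : (\int[kappa]_q `|(rho \o xsection (@assemble R d X @^-1` N)) q| = 0)%E.
  rewrite -M0 /P' /distribution /pushforward /= /product_measure1.
  by apply: eq_integral => q _; rewrite gee0_abs.
apply: filterS => q /(_ I) /= h.
exists (xsection (@assemble R d X @^-1` N) q); split => //.
  exact: measurable_xsection.
by move=> y /= nf; rewrite /xsection/= inE; exact: subN.
Qed.

(** Replace the process by the resampled one, condition on the charges, and
    apply [resampled_positions]. *)
Lemma ordering_law_box (C : set (conic_space R)) n (B : nat -> set X) :
  measurable C -> (forall i, measurable (B i)) ->
  Pr (T @^-1` (C `*` box n B)) = (kappa C * \prod_(i < n) nu (B i))%E.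
Proof.
move=> mC mB; have mF := measurable_box n mB; have mCF := measurableX mC mF.
pose u (eta : dplus_space R X) := U [set w | (C `*` box n B) (T (eta, w))].
have mu : measurable_fun setT u by exact: measurable_ordering_prob.
transitivity (\int[P]_eta u eta)%E.
  rewrite /Pr /= /product_measure1; apply: eq_integral => eta _ /=.
  by congr (U _); apply/seteqP; split => w; rewrite /xsection/= inE.
transitivity (\int[P']_eta u eta)%E.
  by apply: eq_measure_integral => A mA _; exact: resampled_law.
rewrite ge0_integral_distribution//.
rewrite fubini_tonelli1//; last exact: (measurableT_comp mu (@measurable_assemble R d X)).
transitivity (\int[kappa]_q ((\1_C q)%:E * \prod_(i < n) nu (B i)))%E.
  apply: ge0_ae_eq_integral => //.
  - apply: measurable_fun_fubini_tonelli_F => //.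
    exact: (measurableT_comp mu (@measurable_assemble R d X)).
  - by apply: emeasurable_funM => //; apply/measurable_EFinP; exact: measurable_indic.
  - by move=> q _; apply: integral_ge0.
  - by move=> q _; rewrite mule_ge0// ?lee_fin// prode_ge0.
  have := @filterI _ (almost_everywhere kappa) (ae_filter_ringOfSetsType kappa) _ _
    (charges_positive hinf htail hsmall hP hnu U hT) resampled_fair.
  apply: filterS => q [qp qfair] _.
  have [E sepE] := standard_borel_separating hX.
  apply: (resampled_positions (@infinite_powerP R d X nu) hT qp _ qfair) => //.
  exact: (infinite_power_injective (@infinite_powerP R d X nu) sepE hnu).
rewrite ge0_integralZr//=.
- by rewrite integral_indic// setIT.
- by apply/measurable_EFinP; exact: measurable_indic.
- by apply: prode_ge0.
Qed.

Lemma ordering_law_product (C : set (conic_space R)) (F : set (seq_space X)) :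
  measurable C -> measurable F -> Pr (T @^-1` (C `*` F)) = (kappa C * rho F)%E.
Proof.
move=> mC.
have mT A : measurable A -> measurable (T @^-1` A).
  by move=> mA; rewrite -[X in measurable X]setTI; exact: measurable_funPT.
have kE : kappa C = Pr (T @^-1` (C `*` setT)).
  rewrite /kappa /distribution /pushforward; congr (Pr _).
  by apply/seteqP; split => om //= [].
have mCX G : measurable G -> measurable (T @^-1` (C `*` G)).
  by move=> mG; apply: mT; exact: measurableX.
rewrite measurable_boxes; move: F; apply: (dynkin_induction (G := @boxes d X)).
- exact: measurable_boxes.
- exact: boxes_setI.
- by rewrite -kE probability_setT mule1.
- move=> _ [n [B [mB ->]]]; rewrite ordering_law_box//.
  by rewrite -(@infinite_powerP R d X nu n B mB).
- move=> F mF hF.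
  rewrite (_ : T @^-1` (C `*` ~` F) = T @^-1` (C `*` setT) `\` T @^-1` (C `*` F)); last first.
    apply/seteqP; split => om /=.
      by move=> [Com nFom]; split => // -[].
    by move=> [[Com _] h]; split => // Fom; apply: h.
  rewrite measureD//; [|exact: mCX|exact: mCX|]; last first.
    by rewrite (le_lt_trans (probability_le1 _ _)) ?ltry//; exact: mCX.
  rewrite setIidr; last by move=> om /= [].
  rewrite [X in (_ - X)%E](_ : _ = kappa C * rho F)%E; last exact: hF.
  rewrite [X in (X - _)%E](_ : _ = kappa C); last exact/esym/kE.
  rewrite probability_setC// muleBr ?mule1// fin_num_measure//.
- move=> F mF tF hF.
  rewrite (_ : T @^-1` (C `*` \bigcup_k F k) = \bigcup_k (T @^-1` (C `*` F k))); last first.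
    apply/seteqP; split => om /=; first by move=> [Com [k _ Fk]]; exists k.
    by move=> [k _ [Com Fk]]; split => //; exists k.
  rewrite measure_bigcup//; last 2 first.
  + by move=> k _; exact: mCX.
  + by move=> i j _ _ [om [[_ Fi] [_ Fj]]]; apply: tF => //; exists (T om).2.
  have kf : kappa C = (fine (kappa C))%:E by rewrite fineK// fin_num_measure.
  rewrite [in RHS]measure_bigcup// kf -nneseriesZl//; apply: eq_eseriesr => k _.
  by rewrite -kf; exact: hF.
Qed.

End conic_part.

Lemma infinite_power_coord (R : realType) d (X : measurableType d) (nu : probability X R)
  (rho : probability (seq_space X) R) (i : nat) (A : set X) :
  infinite_power nu rho -> measurable A ->
  rho [set y : seq_space X | A ((y : nat -> X) i)] = nu A.
Proof.
move=> hrho mA; have ij : i != i.+1 by rewrite neq_ltn ltnSn.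
rewrite -[RHS]mule1 -(@probability_setT _ _ _ nu) -(infinite_power_pair hrho ij mA measurableT).
by congr (rho _); apply/seteqP; split => y /= => [|[]].
Qed.

Theorem theorem1 (R : realType) (d : measure_display) (X : measurableType d)
    (nu : probability X R)
    (hX : standard_borel R X) (hnu : nonatomic nu)
    (Lambda : {measure set (measurableTypeR R) -> \bar R})
    (hneg : Lambda `]-oo, 0[%classic = 0%E)
    (hzero : Lambda [set 0] = 0%E)
    (hinf : Lambda `]0, +oo[%classic = +oo%E)
    (htail : (Lambda `]1%R, +oo[%classic < +oo)%E)
    (hsmall : (\int[Lambda]_(s in `]0%R, 1%R]%classic) s%:E < +oo)%E)
    (P : probability (dplus_space R X) R)
    (hP : levy_law nu Lambda P)
    (d' : measure_display) (W : measurableType d') (U : probability W R)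
    (T : {mfun (dplus_space R X * W)%type >->
               (conic_space R * seq_space X)%type})
    (hT : ordering_map T)
    (hties : {ae P, forall eta, fair_ties U T eta}) :
  let Pr : probability (dplus_space R X * W)%type R := (P \x U)%E in
  let TP := distribution Pr T in
  let kappa := distribution Pr (charges T) in
  [/\ exists2 nuinf : probability (seq_space X) R,
        infinite_power nu nuinf &
        forall A : set (conic_space R * seq_space X)%type,
          measurable A -> TP A = (kappa \x nuinf)%E A,
      iid_with_law Pr nu (fun i om => (positions T om : nat -> X) i) &
      independent Pr (positions T) (charges T)].
Proof.
move=> Pr TP kappa; set nuinf := power_measure nu.
have nuinfP : infinite_power nu nuinf by exact: infinite_powerP.
have prodE C F : measurable C -> measurable F ->
    Pr (T @^-1` (C `*` F)) = (kappa C * nuinf F)%E.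
  exact: (ordering_law_product hX hnu hinf htail hsmall hP hT hties).
have kappaT : kappa setT = 1%E by exact: (@probability_setT _ _ _ (distribution Pr (charges T))).
have positionsE F : measurable F -> Pr (positions T @^-1` F) = nuinf F.
  move=> mF; have := prodE setT F measurableT mF.
  rewrite kappaT mul1e => <-.
  by congr (Pr _); apply/seteqP; split => om //= [].
have boxE n (B : nat -> set X) : (forall i, measurable (B i)) ->
    Pr [set om | forall i, (i < n)%N -> B i ((positions T om : nat -> X) i)] =
    (\prod_(i < n) nu (B i))%E.
  by move=> mB; rewrite -(nuinfP n B mB) -positionsE//; exact: measurable_box.
have coordE i (B : set X) : measurable B ->
    Pr ((fun om => (positions T om : nat -> X) i) @^-1` B) = nu B.
  move=> mB; rewrite -[RHS](infinite_power_coord i nuinfP mB) -positionsE//.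
  by have := measurable_coord i measurableT mB; rewrite setTI.
split.
- exists nuinf => // A mA; apply/esym.
  exact: (@product_measure_unique _ _ _ _ R (distribution Pr (charges T)) nuinf (distribution Pr T) prodE A mA).
- split => // n B mB; rewrite boxE//; apply: eq_bigr => i _.
  by rewrite coordE.
- move=> F C mF mC; rewrite positionsE//.
  rewrite (_ : _ `&` _ = T @^-1` (C `*` F)); first by rewrite prodE// muleC.
  by apply/seteqP; split => om /= [].
Qed.
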